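(* Let $k,D\ge1$ be integers and let $(X,\mathbb{Z}^k)$ be a dynamical system with $X$ of finite Lebesgue covering dimension. If for every subgroup $A$ of $\mathbb{Z}^k$ $$\operatorname{mdim}(X_A,\mathbb{Z}^k/A)<\frac D2,$$ then $(X,\mathbb{Z}^k)$ embeds into the $D$-cubical shift $(([0,1]^D)^{\mathbb{Z}^k},\sigma)$.
   Context: A dynamical system $(X,G)$ is a continuous action of a group $G$ on a compact metric space $X$, written $(g,x)\mapsto gx$. An embedding of $\mathbb{Z}^k$-actions is a continuous injective equivariant map. $\sigma$ is the shift action of $\mathbb{Z}^k$ on $([0,1]^D)^{\mathbb{Z}^k}$ (product topology), where $m\in\mathbb{Z}^k$ sends $(x_n)_n$ to $(x_{n+m})_n$. For a subgroup $A$ of $\mathbb{Z}^k$, $X_A=\{x\in X: nx=x\text{ for all }n\in A\}$, with the induced action of $\mathbb{Z}^k/A$ given by $(a+A)x=ax$. Mean dimension: for a compact metric space $(Z,d)$ and $\epsilon>0$, $\operatorname{widim}_\epsilon(Z,d)$ is the smallest integer $n$ such that $Z$ has a finite open cover $\mathcal{U}$ all of whose members have diameter at most $\epsilon$ and whose order $-1+\max_{x}\#\{U\in\mathcal{U}:x\in U\}$ is $n$. For a countable abelian group $G$ acting continuously on $Z$, with F\o lner sequence $(F_n)$ of finite subsets of $G$ and $d_{F}(x,y)=\max_{g\in F}d(gx,gy)$, $$\operatorname{mdim}(Z,G)=\sup_{\epsilon>0}\lim_{n\to\infty}\frac{\operatorname{widim}_\epsilon(Z,d_{F_n})}{|F_n|}$$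 (the limit exists and is independent of $(F_n)$). For $G=\mathbb{Z}^k$ one may take $F_n=\{0,\dots,n-1\}^k$; if $G$ is finite, $\operatorname{mdim}(Z,G)=\dim(Z)/|G|$, where $\dim$ is Lebesgue covering dimension. (The condition on $\operatorname{mdim}(X_A,\mathbb{Z}^k/A)$ is regarded as satisfied when $X_A=\emptyset$.) *)

(* Defs.v *)
From HB Require Import structures.
From mathcomp Require Import all_boot all_order all_algebra finmap.
From mathcomp Require Import ring_quotient.
From mathcomp Require Import all_classical all_reals.
From mathcomp Require Import topology ereal normedtype sequences.

Set Implicit Arguments.
Unset Strict Implicit.
Unset Printing Implicit Defensive.

Import Order.TTheory GRing.Theory Num.Theory.
Import numFieldNormedType.Exports.

Local Open Scope classical_set_scope.
Local Open Scope ring_scope.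

(* A subset of a metric space is a metric space for the restricted distance;
   the library already equips [set_type A] with the induced topology. *)
Section SubsetMetric.
Context {R : realType} {X : metricType R} (A : set X).

Definition subset_mdist (x y : A) : R := mdist (set_val x) (set_val y).

Fact subset_mdist_ge0 x y : 0 <= subset_mdist x y.
Proof. exact: mdist_ge0. Qed.

Fact subset_mdist_positivity x y : subset_mdist x y = 0 -> x = y.
Proof. by move=> /mdist_positivity; exact: val_inj. Qed.

Fact subset_ballE (x : A) (e : R) : ball x e = [set y | subset_mdist x y < e].
Proof.
rewrite [LHS](_ : _ = set_val @^-1` ball (set_val x) e)//.
by rewrite ballEmdist.
Qed.

HB.instance Definition _ := PseudoMetric_isMetric.Build R (set_type A)
  subset_mdist_ge0 subset_mdist_positivity subset_ballE.
End SubsetMetric.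

(* The acting group is discrete, so continuity of the action amounts to
   continuity of each of its elements. *)
Record action (G : zmodType) (X : topologicalType) := Action {
  act :> G -> X -> X;
  act0 : forall x, act 0 x = x;
  actD : forall g h x, act (g + h) x = act g (act h x);
  act_continuous : forall g, continuous (act g) }.

Definition embeds (G : zmodType) (X Y : topologicalType)
    (a : action G X) (b : action G Y) : Prop :=
  exists f : X -> Y, [/\ continuous f, injective f &
    forall g x, f (a g x) = b g (f x)].

(* [zmodClosed G] is the type of subgroups of [G]; despite its name,
   [{ideal_quot A}] is the quotient group [G / A] for any such [A]. *)
Section Induced.
Context (G : zmodType) (X : topologicalType) (a : action G X)
  (A : zmodClosed G).

Definition fixed_set : set X := [set x | forall n, n \in A -> a n x = x].

Fact fixed_set_act g x : fixed_set x -> fixed_set (a g x).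
Proof. by move=> xA n nA; rewrite -actD addrC actD xA. Qed.

Definition induced_act (q : {ideal_quot A}) (x : fixed_set) : fixed_set :=
  exist _ (a (repr q) (set_val x))
    (mem_set (fixed_set_act (repr q) (set_mem (valP x)))).

Fact fixed_set_eqmod (g h : G) x : fixed_set x -> g - h \in A -> a g x = a h x.
Proof. by move=> xA ghA; rewrite -[g](subrK h) addrC actD xA. Qed.

Lemma induced_actE (g : G) (x : fixed_set) :
  set_val (induced_act (\pi_({ideal_quot A})%qT g) x) = a g (set_val x).
Proof.
apply: fixed_set_eqmod; first exact: set_mem (valP x).
by rewrite Quotient.idealrBE reprK.
Qed.

Fact induced_act0 x : induced_act 0 x = x.
Proof.
apply: val_inj => /=; rewrite -[LHS]/(set_val (induced_act 0 x)).
by rewrite -(raddf0 \pi_({ideal_quot A})%qT) induced_actE act0.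
Qed.

Fact induced_actD p q x :
  induced_act (p + q) x = induced_act p (induced_act q x).
Proof.
apply: val_inj; rewrite -[RHS]/(a (repr p) (a (repr q) (set_val x))).
rewrite -[p in LHS]reprK -[q in LHS]reprK -raddfD.
by rewrite -actD -induced_actE.
Qed.

Fact induced_act_continuous q : continuous (induced_act q).
Proof.
apply: continuous_comp_initial => x.
apply: (@continuous_comp _ _ _ (set_val : fixed_set -> X) (a (repr q))).
  exact: initial_continuous.
exact: act_continuous.
Qed.

Definition induced_action : action {ideal_quot A} fixed_set :=
  Action induced_act0 induced_actD induced_act_continuous.

End Induced.

Arguments induced_action {G X} a A.

Definition finite_open_cover (X : topologicalType) (U : set (set X)) : Prop :=
  [/\ finite_set U, (forall V, U V -> open V) &
    forall x, exists2 V, U V & V x].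

Definition order_le (X : Type) (U : set (set X)) (n : nat) : Prop :=
  forall x, (U `&` [set V | V x] #<= `I_n.+1)%card.

(* Lebesgue covering dimension; [covering_dim_le X 0] also holds for the empty
   space, whose dimension is -1. *)
Definition covering_dim_le (X : topologicalType) (n : nat) : Prop :=
  forall U : set (set X), finite_open_cover U ->
    exists V : set (set X), [/\ finite_open_cover V,
      (forall W, V W -> exists2 W', U W' & W `<=` W') & order_le V n].

Definition finite_dimensional (X : topologicalType) : Prop :=
  exists n, covering_dim_le X n.

Definition diam_le (X : Type) (R : realType) (d : X -> X -> R) (V : set X)
    (e : R) : Prop :=
  forall x y, V x -> V y -> d x y <= e.

(* An infimum of natural numbers, hence their minimum when there is one. *)
Definition widim (R : realType) (X : topologicalType) (e : R)
    (d : X -> X -> R) : \bar R :=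
  ereal_inf [set n%:R%:E | n in [set n : nat | exists U : set (set X),
    [/\ finite_open_cover U, (forall V, U V -> diam_le d V e) &
      order_le U n]]].

Definition folner (R : realType) (G : zmodType) (F : nat -> {fset G}) : Prop :=
  (forall n, F n != fset0) /\
  forall g : G,
    let gF n := [fset (g + h)%R | h in F n]%fset in
    (fun n => (#|` (F n `\` gF n) `|` (gF n `\` F n)|%fset)%:R
      / (#|` F n|%fset)%:R : R) @ \oo --> (0 : R).

Section MeanDimension.
Context {R : realType} {G : zmodType} {X : metricType R} (a : action G X).

Definition orbit_mdist (F : {fset G}) (x y : X) : R :=
  \big[Order.max/0]_(g <- F) mdist (a g x) (a g y).

Definition mdim_along (F : nat -> {fset G}) : \bar R :=
  ereal_sup [set limn (fun n => (widim e (orbit_mdist (F n))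
                                 * ((#|` F n|%fset)%:R^-1)%:E)%E)
            | e in [set e : R | 0 < e]].

(* The value does not depend on the Folner sequence; one exists when [G] is
   countable, so the default of [xget] plays no role then. *)
Definition mdim : \bar R :=
  mdim_along (xget (fun=> fset0) [set F | folner R F]).

End MeanDimension.

Section CubicalShift.
Context (R : realType) (D k : nat).

Definition unit_interval : set R := `[0, 1].

Definition cube : topologicalType := {ptws 'I_D -> unit_interval}.

Definition cube_seq : topologicalType := {ptws 'rV[int]_k -> cube}.

Definition shift_act (m : 'rV[int]_k) (x : cube_seq) : cube_seq :=
  fun n => x (n + m).

Fact shift_act0 x : shift_act 0 x = x.
Proof. by apply/funext => n; rewrite /shift_act addr0. Qed.

Fact shift_actD m m' x : shift_act (m + m') x = shift_act m (shift_act m' x).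
Proof. by apply/funext => n; rewrite /shift_act addrA. Qed.

Fact shift_act_continuous m : continuous (shift_act m).
Proof.
move=> x; apply/cvg_sup; first exact/fmap_filter/(nbhs_filter x).
move=> n.
apply: (@continuous_comp_initial _ cube_seq cube (fun f => f n)) => y.
exact: (@proj_continuous _ (fun=> cube) (n + m) y).
Qed.

Definition cubical_shift : action 'rV[int]_k cube_seq :=
  Action shift_act0 shift_actD shift_act_continuous.

End CubicalShift.

(* Main.v *)
Require Import Defs.
From HB Require Import structures.
From mathcomp Require Import all_boot all_order all_algebra finmap.
From mathcomp Require Import ring_quotient.
From mathcomp Require Import all_classical all_reals.
From mathcomp Require Import topology ereal normedtype sequences numfun derive.
From mathcomp Require Import lra zify.

(** A continuous [F : X -> R^D] induces an equivariant map [x |-> (F (n x))_n],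
    and it is to be shown that a generic [F] makes this map injective. The set
    of pairs [x <> y] is covered by countably many compact pieces, and for each
    piece the functions separating all its pairs contain an open dense set; a
    Baire argument ([generic_separation]) then gives one [F] for all pieces.

    Fix a pair. Every subgroup of [Z^k] is finitely generated ([subgroup_fg]),
    so the stabilizer of [x] is captured by a finite list [S], and countably
    many sets [fixed_by S] suffice. Let [n] bound the dimension of [fixed_by S],
    and let [N] be the number of points of the orbit of [x] that are put to use.
    When the orbit is finite all of it is used, and the hypothesis on mean
    dimension gives [2n < ND] ([widim_lt_mdim]): for a finite quotient a Folner
    sequence is eventually the whole group, and widim at scale [e] bounds the
    order of some cover of mesh [e]. When the orbit is infinite, [n] bounds the
    dimension of [X] and [N] is any large number ([orbit_type_exists]).

    Density is a general position argument. Near the pair, the value of [F] at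
    an orbit point [g x'] is replaced by an average of vectors [u_j], weighted
    by a partition of unity of order [n] in [x'] ([interpolate]); the vectors
    can be chosen freely near the old values. A coincidence of the two orbits of
    values becomes a linear relation between few vectors of [R^(ND)], and such
    relations are avoided by choosing the vectors one after another outside the
    spans of few previous ones ([general_position]).

    If [x] and [y] lie in different orbits, only the values on the orbit with
    the larger [N] are moved; the relation has at most [n + n' + 2 <= ND + 1]
    terms ([perturb_pair]). If [y = h x], the constraints [F (g x) = F (g h x)]
    are not independent. Ordering the points, at least half of the edges from
    [g x] to [g h x] go in the same direction ([descending_half]); these edges
    form no cycle, so the differences along them are independent, and they have
    at least [ND / 2 > n] coordinates ([perturb_translate]). *)

Set Implicit Arguments.
Unset Strict Implicit.
Unset Printing Implicit Defensive.

Import Order.TTheory GRing.Theory Num.Theory.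
Import numFieldNormedType.Exports.

Local Open Scope classical_set_scope.
Local Open Scope ring_scope.

(** * General position in real vector spaces *)

Section GeneralPosition.
Context {R : realFieldType}.

Lemma exists_small_nonroot (p : {poly R}) (e : R) :
  p != 0 -> 0 < e -> exists t, [/\ 0 < t, t <= e & ~~ root p t].
Proof.
move=> p0 e0; apply: contrapT => nex.
pose rs := [seq e / k.+1%:R | k <- iota 0 (size p)].
have rs_roots : all (root p) rs.
  apply/allP => _ /mapP[k _ ->].
  apply: contrapT => nr; apply: nex; exists (e / k.+1%:R); split.
  - by rewrite divr_gt0.
  - by rewrite ler_pdivrMr// ler_peMr ?ler1n// ltW.
  - exact/negP.
have rs_uniq : uniq rs.
  rewrite map_inj_uniq ?iota_uniq// => i j /(mulfI (lt0r_neq0 e0)) /invr_inj.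
  by move/eqP; rewrite eqr_nat => /eqP [].
by have := max_poly_roots p0 rs_roots rs_uniq; rewrite size_map size_iota ltnn.
Qed.

Lemma exists_annihilator (q n : nat) (v : 'M[R]_(q, n)) : (q < n)%N ->
  exists l : 'cV[R]_n, l != 0 /\ v *m l = 0.
Proof.
move=> qn; have : kermx v^T != 0.
  rewrite kermx_eq0; apply/negP => /eqP vfree.
  by have := rank_leq_col v^T; rewrite vfree leqNgt qn.
move=> /rowV0Pn[u /sub_kermxP uv u0]; exists u^T; split.
  by rewrite trmx_eq0.
by apply: trmx_inj; rewrite trmx_mul trmxK uv trmx0.
Qed.

(** Each span of at most [M] of the vectors is killed by a nonzero functional
    [l S]. Along the curve [(t, t^2, .., t^M)] the value of [l S] at the moving
    vector is a nonzero polynomial in [t], and finitely many polynomials have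
    a common non-root as small as needed. The extra coordinate [1] makes linear
    relations between these rows affine relations between points. *)
Lemma avoid_spans (J : finType) M (v : J -> 'rV[R]_(M + 1)) (b : 'rV[R]_M)
    (e : R) : 0 < e ->
  exists w : 'rV[R]_M, (forall i, `|w 0 i| <= e) /\
    forall d : J -> R, (\sum_s (d s != 0%R) <= M)%N ->
      row_mx (b + w) 1%:M != \sum_s d s *: v s.
Proof.
move=> e0.
have annih (S : {set J}) : exists l : 'cV[R]_(M + 1), l != 0 /\
    ((#|S| <= M)%N -> forall s, s \in S -> v s *m l = 0).
  have [SM|SM] := leqP #|S| M; last first.
    by exists (const_mx 1); split=> //; apply/cV0Pn; exists (rshift M 0);
      rewrite mxE oner_eq0.
  have [|l [l0 lv]] := @exists_annihilator #|S| (M + 1)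
    (\matrix_(i < #|S|) v (enum_val i)); first by rewrite addn1 ltnS.
  exists l; split=> // _ s sS.
  have := congr1 (row (enum_rank_in sS s)) lv.
  by rewrite row_mul rowK enum_rankK_in// row0.
pose l S := projT1 (cid (annih S)).
have l0 S : l S != 0 by rewrite /l; case: cid => ? [].
have lS (S : {set J}) : (#|S| <= M)%N -> forall s, s \in S -> v s *m l S = 0.
  by rewrite /l; case: cid => ? [].
pose P (S : {set J}) : {poly R} :=
  (((b *m usubmx (l S)) 0 0 + dsubmx (l S) 0 0)%:P +
   \sum_(k < M) usubmx (l S) k 0 *: 'X^(k.+1))%R.
have PE S t : (P S).[t] = (row_mx (b + \row_k t ^+ k.+1) 1%:M *m l S) 0 0.
  rewrite -[l S in RHS]vsubmxK mul_row_col mul1mx mulmxDl [RHS]mxE.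
  rewrite [X in _ = X + _]mxE /P hornerD hornerC horner_sum addrAC.
  congr (_ + _ + _); rewrite [RHS]mxE.
  by apply: eq_bigr => k _; rewrite hornerZ hornerXn [in RHS]mxE mulrC.
have Pcoef S k : (P S)`_k.+1 = if insub k is Some k' then usubmx (l S) k' 0 else 0.
  rewrite /P coefD coefC /= add0r coef_sum.
  case: insubP => [k' _ k'k|kM].
    rewrite (bigD1 k')//= coefZ coefXn k'k eqxx mulr1 big1 ?addr0// => i ik.
    rewrite coefZ coefXn eqSS -k'k; case: eqP => [ki|]; last by rewrite mulr0.
    by move: ik; rewrite (_ : i = k') ?eqxx//; exact: val_inj.
  rewrite big1// => i _; rewrite coefZ coefXn eqSS.
  by case: eqP => [ki|]; [move: kM; rewrite ki ltn_ord|rewrite mulr0].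
have Pneq0 S : P S != 0.
  apply/eqP => P0; move: (l0 S); rewrite -[l S]vsubmxK.
  have u0 : usubmx (l S) = 0.
    apply/colP => i; rewrite [RHS]mxE.
    by have := Pcoef S i; rewrite P0 coef0 valK => <-.
  have d0 : dsubmx (l S) = 0.
    apply/colP => i; rewrite (ord1 i) [RHS]mxE.
    have /(congr1 (fun p : {poly R} => p`_0)) := P0.
    rewrite /P coefD coefC u0 mulmx0 mxE add0r coef_sum big1 ?addr0 ?coef0//.
    by move=> k _; rewrite coefZ mxE mul0r.
  by rewrite u0 d0 col_mx0 eqxx.
have PP0 : \prod_(S : {set J}) P S != 0 by apply/prodf_neq0 => S _; exact: Pneq0.
have e10 : 0 < Num.min e 1 by rewrite lt_min e0 ltr01.
have [t [t0 te /negP tr]] := exists_small_nonroot PP0 e10.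
move: te; rewrite le_min => /andP[te t1].
exists (\row_k t ^+ k.+1); split=> [i|d dM].
  have t0' := ltW t0; rewrite mxE ger0_norm ?exprn_ge0// exprSr.
  by apply: le_trans te; rewrite ler_piMl// exprn_ile1.
apply/eqP => rowE; apply: tr; pose S : {set J} := finset (fun s => d s != 0).
rewrite /root horner_prod; apply/prodf_eq0; exists S => //; apply/eqP.
rewrite PE rowE mulmx_suml big1 ?mxE// => s _.
have [ds|ds] := eqVneq (d s) 0; first by rewrite ds scale0r mul0mx.
rewrite -scalemxAl lS ?scaler0// ?inE//.
by rewrite cardsE -sum1_card big_mkcond.
Qed.

(** The rows [row_mx (b j + w j) 1] are chosen one after another, each outside
    the spans of at most [M] of the vectors present so far: the last new vector
    in a relation with at most [M + 1] terms would lie in such a span. *)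
Lemma general_position M r (v : nat -> 'rV[R]_(M + 1)) (b : nat -> 'rV[R]_M)
    (e : R) (m : nat) : 0 < e ->
  exists w : nat -> 'rV[R]_M, (forall j i, `|w j 0 i| <= e) /\
    forall c d : nat -> R,
      \sum_(s < r) c s *: v s
        + \sum_(j < m) d j *: row_mx (b j + w j) 1%:M = 0 ->
      (\sum_(s < r) (c s != 0%R) + \sum_(j < m) (d j != 0%R) <= M.+1)%N ->
      forall j, (j < m)%N -> d j = 0.
Proof.
move=> e0; elim: m => [|m [w [we IH]]].
  by exists (fun=> 0); split=> // j i; rewrite mxE normr0 ltW.
pose V (s : 'I_r + 'I_m) := match s with
  | inl s => v s | inr j => row_mx (b j + w j) 1%:M end.
have [x [xe xP]] := avoid_spans V (b m) e0.
pose w' j := if j == m then x else w j.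
have w'E (j : 'I_m) : w' j = w j by rewrite /w' ltn_eqF.
exists w'; split=> [j i|c d]; first by rewrite /w'; case: ifP.
rewrite !big_ord_recr /= {2}/w' eqxx.
under [X in _ + (X + _)]eq_bigr do rewrite w'E.
have [dm|dm] := eqVneq (d m) 0.
  rewrite dm scale0r addr0 addn0 => /IH{}IH /IH{}IH j.
  by rewrite ltnS leq_eqVlt => /predU1P[-> //|/IH].
rewrite addrA => E; rewrite /= addn1 addnS ltnS => cM; exfalso.
pose D (s : 'I_r + 'I_m) := - (d m)^-1 * match s with
  | inl s => c s | inr j => d j end.
have DM : (\sum_s (D s != 0%R) <= M)%N.
  rewrite big_sumType /=; apply: leq_trans cM; apply/eq_leq; congr (_ + _)%N;
  by apply: eq_bigr => i _; rewrite /D mulf_eq0 oppr_eq0 invr_eq0 (negPf dm).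
move/eqP: (xP D DM); apply.
rewrite big_sumType /= /D /V.
under eq_bigr do rewrite -scalerA.
under [X in _ = _ + X]eq_bigr do rewrite -scalerA.
rewrite -!scaler_sumr -scalerDr.
move/eqP: E; rewrite addr_eq0 => /eqP ->.
by rewrite scaleNr scalerN opprK scalerA mulVf// scale1r.
Qed.

End GeneralPosition.

Section MatrixGeneralPosition.
Context {R : realFieldType}.

(** Two convex combinations with equal values form a linear relation between the
    rows extended by [1], to which [general_position] applies. *)
Lemma general_position_mx N D (r m : nat) (u u' : nat -> 'M[R]_(N, D)) (e : R) :
  0 < e -> exists W : nat -> 'M[R]_(N, D), (forall j i c, `|W j i c| <= e) /\
    forall phi psi : nat -> R,
      \sum_(j < m) phi j = 1 -> \sum_(s < r) psi s = 1 ->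
      (\sum_(j < m) (phi j != 0%R) + \sum_(s < r) (psi s != 0%R) <= (N * D).+1)%N ->
      \sum_(j < m) phi j *: (u j + W j) != \sum_(s < r) psi s *: u' s.
Proof.
move=> e0.
have [w [we wP]] := @general_position R (N * D) r
  (fun s => row_mx (mxvec (u' s)) 1%:M) (fun j => mxvec (u j)) e m e0.
exists (fun j => vec_mx (w j)); split=> [j i c|phi psi phi1 psi1 cnt].
  by rewrite mxE.
apply/eqP => E; suff phi0 (j : 'I_m) : phi j = 0.
  by move: phi1; rewrite big1// => /eqP; rewrite eq_sym oner_eq0.
apply: (wP (fun s => - psi s) phi) => //; last first.
  rewrite addnC; apply: leq_trans cnt; rewrite leq_add2l; apply/eq_leq.
  by apply: eq_bigr => s _; rewrite oppr_eq0.
have rowS n (c : nat -> R) (x : nat -> 'rV[R]_(N * D)) :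
    \sum_(s < n) c s *: row_mx (x s) (1%:M : 'M_1) =
    row_mx (\sum_(s < n) c s *: x s) (\sum_(s < n) c s)%:M.
  elim: n => [|n IH]; first by rewrite !big_ord0 raddf0 row_mx0.
  by rewrite !big_ord_recr/= IH scale_row_mx scale_scalar_mx mulr1 add_row_mx
    raddfD.
rewrite /= (rowS r (fun s => - psi s) (fun s => mxvec (u' s))).
rewrite (rowS m phi (fun j => mxvec (u j) + w j)).
rewrite add_row_mx sumrN psi1 -raddfD/= phi1 addNr raddf0.
suff -> : \sum_(s < m) phi s *: (mxvec (u s) + w s) =
    \sum_(s < r) psi s *: mxvec (u' s).
  by under eq_bigr do rewrite scaleNr; rewrite sumrN addNr row_mx0.
apply: (can_inj vec_mxK); rewrite !linear_sum/=.
under eq_bigr do rewrite linearZ linearD/= mxvecK.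
by under [RHS]eq_bigr do rewrite linearZ/= mxvecK.
Qed.

(** Such a [Q] is strictly triangular once the indices are sorted by [rho]; a
    vector fixed by [Q] vanishes by induction on [rho]. *)
Lemma unitmx_decreasing N (Q : 'M[R]_N) (rho : 'I_N -> nat) :
  (forall i l, Q i l != 0 -> (rho l < rho i)%N) -> 1%:M - Q \in unitmx.
Proof.
move=> Qrho; rewrite -unitmx_tr -row_free_unit -kermx_eq0.
apply/negPn/negP => /rowV0Pn[v /sub_kermxP vQ] /negP; apply; apply/eqP.
have vE : v^T = Q *m v^T.
  apply: trmx_inj; rewrite trmx_mul trmxK; apply/eqP; rewrite -subr_eq0.
  by rewrite -{1}[v]mulmx1 -mulmxBr -[X in X - _]trmx1 -raddfB /= vQ.
have v0 n i : (rho i < n)%N -> v^T i 0 = 0.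
  elim: n i => // n IH i; rewrite ltnS => in_; rewrite vE mxE big1// => l _.
  have [->|/Qrho li] := eqVneq (Q i l) 0; first by rewrite mul0r.
  by rewrite IH ?mulr0// (leq_trans li).
by apply/rowP => i; have := v0 _ i (leqnn _); rewrite !mxE.
Qed.

Lemma convex_close m (phi u : nat -> R) (t e : R) :
  \sum_(j < m) phi j = 1 -> (forall j, 0 <= phi j) ->
  (forall j, (j < m)%N -> phi j != 0 -> `|u j - t| <= e) ->
  `|\sum_(j < m) phi j * u j - t| <= e.
Proof.
move=> phi1 phi0 ut; rewrite -[t]mul1r -phi1 mulr_suml -sumrB.
apply: (le_trans (ler_norm_sum _ _ _)).
rewrite -[e]mul1r -phi1 mulr_suml; apply: ler_sum => j _.
rewrite -mulrBr normrM ger0_norm//.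
have [->|pj] := eqVneq (phi j) 0; first by rewrite !mul0r.
by rewrite ler_wpM2l// ut.
Qed.

End MatrixGeneralPosition.

(** * Subgroups of Z^k *)

(** Downward induction on the first possibly nonzero coordinate: one more
    generator is enough, an element of the subgroup for which that coordinate is
    positive and minimal, since Euclidean division by it clears the coordinate. *)
Lemma subgroup_fg_from k (A : zmodClosed 'rV[int]_k) (i : nat) : (i <= k)%N ->
  exists S : seq 'rV[int]_k, {subset S <= A} /\
    forall B : zmodClosed 'rV[int]_k, {subset S <= B} ->
      forall v, v \in A -> (forall j : 'I_k, (j < k - i)%N -> v 0 j = 0) ->
      v \in B.
Proof.
elim: i => [_|i IH ik].
  exists [::]; split=> // B _ v _ v0; suff -> : v = 0 by rewrite rpred0.
  by apply/rowP => j; rewrite v0 ?mxE ?subn0.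
have [S [SA SP]] := IH (ltnW ik).
have cP : (k - i.+1 < k)%N by rewrite ltn_subrL (leq_trans _ ik).
pose c := Ordinal cP; pose low (v : 'rV[int]_k) :=
  forall j : 'I_k, (j < c)%N -> v 0 j = 0.
have next (v : 'rV[int]_k) : low v -> v 0 c = 0 ->
    forall j : 'I_k, (j < k - i)%N -> v 0 j = 0.
  move=> vlow vc j; rewrite (_ : k - i = c.+1)%N; last by rewrite subnSK.
  rewrite ltnS leq_eqVlt => /predU1P[jc|/vlow//].
  by rewrite (_ : j = c)//; exact: val_inj.
pose P (n : nat) :=
  `[< exists v, [/\ v \in A, low v & v 0 c = n.+1%:Z] >].
have [exP|nexP] := pselect (exists n, P n); last first.
  exists S; split=> // B SB v vA vlow; apply: SP => //; apply: next => //.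
  apply/eqP; apply: contrapT => /negP vc; apply: nexP.
  exists (absz (v 0 c)).-1; apply/asboolP; exists (v *~ sgz (v 0 c)); split.
  - by rewrite rpredMz.
  - by move=> j jc; rewrite -scaler_int mxE (vlow _ jc) mulr0.
  - by rewrite -scaler_int mxE intz -abszEsg prednK ?absz_gt0.
have [n /asboolP[s [sA slow sc]] nmin] := ex_minnP exP.
exists (s :: S); split=> [x|B sSB v vA vlow].
  by rewrite inE => /predU1P[->//|/SA].
have sB : s \in B by apply: sSB; rewrite mem_head.
have SB : {subset S <= B} by move=> x xS; apply: sSB; rewrite inE xS orbT.
set z := v 0 c; pose q := (z %/ n.+1%:Z)%Z; pose r := (z %% n.+1%:Z)%Z.
have zE : z = q * n.+1%:Z + r by exact: divz_eq.
have r_ge0 : 0 <= r by exact: modz_ge0.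
have r_lt : r < n.+1%:Z by exact: ltz_pmod.
have uE : (v - s *~ q) 0 c = r.
  by rewrite -scaler_int !mxE sc -/z intz zE addrC addKr.
have uA : v - s *~ q \in A by rewrite rpredB// rpredMz.
have ulow : low (v - s *~ q).
  by move=> j jc; rewrite -scaler_int !mxE (vlow _ jc) (slow _ jc) mulr0 subr0.
rewrite -[v](subrK (s *~ q)) rpredD ?rpredMz//.
apply: SP => //; apply: next => //; rewrite uE.
(* a nonzero remainder would contradict the minimality of [n] *)
apply/eqP; apply: contrapT => /negP r0.
have /nmin : P (absz r).-1; last by lia.
by apply/asboolP; exists (v - s *~ q); split=> //; rewrite uE; lia.
Qed.

Lemma subgroup_fg k (A : zmodClosed 'rV[int]_k) :
  exists S : seq 'rV[int]_k, {subset S <= A} /\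
    forall B : zmodClosed 'rV[int]_k, {subset S <= B} -> {subset A <= B}.
Proof.
have [S [SA SP]] := subgroup_fg_from A (leqnn k).
by exists S; split=> // B SB v vA; apply: SP => // j; rewrite subnn.
Qed.

(** * Compact metric spaces and partitions of unity *)

Section MetricTools.
Context {R : realType} {X : metricType R}.
Implicit Types (f : X -> R) (K : set X).

Lemma uniform_pos (I : finType) (P : I -> R -> Prop) :
  (forall i d d', P i d -> 0 < d' -> d' <= d -> P i d') ->
  (forall i, exists2 d, 0 < d & P i d) ->
  exists2 d, 0 < d & forall i, P i d.
Proof.
move=> Pdown Pex; pose d i := s2val (cid2 (Pex i)).
have d0 i : 0 < d i by rewrite /d; case: cid2.
have dP i : P i (d i) by rewrite /d; case: cid2.
have m0 : 0 < \big[Num.min/1]_i d i by exact: lt_bigmin.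
by exists (\big[Num.min/1]_i d i) => // i; apply: Pdown (dP i) _ _ => //;
  exact: bigmin_le.
Qed.

Lemma compact_pos_min (T : topologicalType) (K : set T) (h : T -> R) :
  compact K -> continuous h -> (forall t, K t -> 0 < h t) ->
  exists2 d, 0 < d & forall t, K t -> d <= h t.
Proof.
move=> cK ch hK; have [->|/set0P K0] := eqVneq K set0; first by exists 1.
have [c /set_mem cin cmin] := compact_EVT_min K0 cK (continuous_subspaceT ch).
by exists (h c); [exact: hK|move=> t Kt; apply: cmin; rewrite inE].
Qed.

Lemma continuous_mdistP f : continuous f <-> forall x e, 0 < e ->
  exists2 d, 0 < d & forall y, mdist x y < d -> `|f x - f y| < e.
Proof.
split=> [cf x e e0|H x].
  have /cvgrPdist_lt/(_ _ e0)/nbhs_ballP[d d0 dP] := cf x.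
  by exists d => // y xy; apply: dP; rewrite ballEmdist.
apply/cvgrPdist_lt => e e0; have [d d0 dP] := H x e e0.
by apply/nbhs_ballP; exists d => // y; rewrite ballEmdist => /dP.
Qed.

Lemma mdist_continuous : continuous (fun p : X * X => mdist p.1 p.2).
Proof.
move=> [x y]; apply/cvgrPdist_lt => e e0 /=.
have e20 : 0 < e / 2 by rewrite divr_gt0.
exists (ball x (e / 2), ball y (e / 2)); first by split; exact: nbhsx_ballx.
move=> [x' y'] /=; rewrite !ballEmdist /= => -[xx' yy'].
have := metric_triangle x x' y; have := metric_triangle x' y' y.
have := metric_triangle x' x y'; have := metric_triangle x y y'.
rewrite (metric_sym x' x) (metric_sym y' y) => *.
by rewrite ltr_norml; apply/andP; split; lra.
Qed.

Lemma mdistr_continuous (x : X) : continuous (mdist x).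
Proof.
move=> y; apply: (@continuous_comp _ _ _ (fun y => (x, y))
  (fun p : X * X => mdist p.1 p.2)); last exact: mdist_continuous.
by apply: cvg_pair; [exact: cvg_cst|exact: cvg_id].
Qed.

Lemma open_mdist_lt (x : X) e : open [set y | mdist x y < e].
Proof.
have -> : [set y | mdist x y < e] = mdist x @^-1` [set r | r < e] by [].
by apply: open_comp; [move=> y _; exact: mdistr_continuous|exact: open_lt].
Qed.

Lemma closed_mdist_le (x : X) e : closed [set y | mdist x y <= e].
Proof.
have -> : [set y | mdist x y <= e] = mdist x @^-1` [set r | r <= e] by [].
by apply: closed_comp; [move=> y _; exact: mdistr_continuous|exact: closed_le].
Qed.

(** The distance is positive, hence bounded below, on the compact set of pairs
    on which [f] varies by at least [e]. *)
Lemma compact_unif_continuous f : compact [set: X] -> continuous f ->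
  forall e, 0 < e ->
    exists2 d, 0 < d & forall x y, mdist x y < d -> `|f x - f y| < e.
Proof.
move=> cX cf e e0; pose h (p : X * X) := `|f p.1 - f p.2|.
have ch : continuous h.
  move=> p; apply: cvg_norm; apply: cvgB.
    by apply: (@continuous_comp _ _ _ fst f); [exact: cvg_fst|exact: cf].
  by apply: (@continuous_comp _ _ _ snd f); [exact: cvg_snd|exact: cf].
have cC : compact [set p | e <= h p].
  apply: (@subclosed_compact _ _ ([set: X] `*` [set: X])) => //.
    have -> : [set p | e <= h p] = h @^-1` [set t | e <= t] by [].
    by apply: closed_comp; [move=> p _; exact: ch|exact: closed_ge].
  exact: compact_setX.
have [|d d0 dP] := compact_pos_min cC mdist_continuous.
  move=> -[x y] /=; rewrite /h/= => exy; rewrite mdist_gt0; apply/eqP => xy.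
  by move: exy; rewrite xy subrr normr0 leNgt e0.
exists d => // x y; apply: contraTT; rewrite -!leNgt => hxy.
exact: (dP (x, y)).
Qed.

End MetricTools.

Lemma continuous_sum {R : realType} {T : topologicalType} (I : finType)
    (F : I -> T -> R) :
  (forall i, continuous (F i)) -> continuous (fun x => \sum_i F i x).
Proof.
move=> cF; apply: continuous_big => [|i _]; [|exact: cF].
exact: add_continuous.
Qed.

Section SmallCovers.
Context {R : realType} {X : metricType R}.
Implicit Types (K O : set X).

(** The distance to the complement of [O], capped at [1] so that it makes sense
    when [O] is the whole space. *)
Definition outdist O (x : X) : R :=
  inf [set r | r = 1 \/ exists2 y, ~ O y & r = mdist x y].

Lemma outdist_has_inf O x :
  has_inf [set r : R | r = 1 \/ exists2 y, ~ O y & r = mdist x y].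
Proof.
split; first by exists 1; left.
by exists 0 => _ [->|[y _ ->]]; rewrite ?ler01 ?mdist_ge0.
Qed.

Lemma outdist_le O x r :
  r = 1 \/ (exists2 y, ~ O y & r = mdist x y) -> outdist O x <= r.
Proof. by move=> rP; apply: ge_inf => //; case: (outdist_has_inf O x). Qed.

Lemma le_outdist O x r : r <= 1 -> (forall y, ~ O y -> r <= mdist x y) ->
  r <= outdist O x.
Proof.
move=> r1 rO; apply: lb_le_inf; first by case: (outdist_has_inf O x).
by move=> _ [->//|[y /rO ? ->]].
Qed.

Lemma outdist_ge0 O x : 0 <= outdist O x.
Proof. by apply: le_outdist => // y _; exact: mdist_ge0. Qed.

Lemma outdist_gt0 O x : open O -> O x -> 0 < outdist O x.
Proof.
move=> oO Ox; have /nbhs_ballP[e e0 eO] : nbhs x O by exact: open_nbhs_nbhs.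
apply: (@lt_le_trans _ _ (Num.min e 1)); first by rewrite lt_min e0 ltr01.
apply: le_outdist => [|y nOy]; first by rewrite ge_min lexx orbT.
rewrite ge_min leNgt; apply/orP; left; apply/negP => xy; apply: nOy.
by apply: eO; rewrite ballEmdist.
Qed.

Lemma outdist_out O x : ~ O x -> outdist O x = 0.
Proof.
move=> nOx; apply/eqP; rewrite eq_le outdist_ge0 andbT.
by apply: outdist_le; right; exists x; rewrite ?mdistxx.
Qed.

Lemma outdist_lip O x y : outdist O x <= outdist O y + mdist x y.
Proof.
rewrite -lerBlDr; apply: le_outdist => [|z nOz]; rewrite lerBlDr.
  apply: (le_trans (@outdist_le O x 1 _)); first by left.
  by rewrite lerDl mdist_ge0.
apply: (le_trans (@outdist_le O x (mdist x z) _)); first by right; exists z.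
by rewrite addrC metric_triangle.
Qed.

Lemma outdist_continuous O : continuous (outdist O).
Proof.
apply/continuous_mdistP => x e e0; exists e => // y xy.
have := outdist_lip O x y; have := outdist_lip O y x; rewrite (metric_sym y).
by move=> *; rewrite ltr_norml; apply/andP; split; lra.
Qed.

(** For compact [K] this says that [K] has covering dimension at most [n]. The
    open sets live in [X], but only their traces on [K] are constrained, and they
    are listed rather than collected in a set so that they can be counted. *)
Definition small_cover K (n : nat) : Prop := forall e, 0 < e ->
  exists s : seq (set X), [/\ (forall V, V \in s -> open V),
    (forall x, K x -> has (fun V => `[< V x >]) s),
    (forall V x y, V \in s -> K x -> V x -> K y -> V y -> mdist x y <= e) &
    (forall x, K x -> (count (fun V => `[< V x >]) s <= n.+1)%N)].

Lemma small_cover_sub K K' n n' : K' `<=` K -> (n <= n')%N ->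
  small_cover K n -> small_cover K' n'.
Proof.
move=> K'K nn' H e e0; have [s [so sK sd sn]] := H e e0.
exists s; split=> //.
- by move=> x /K'K; exact: sK.
- by move=> V x y Vs /K'K Kx Vx /K'K Ky; exact: sd Vs Kx Vx Ky.
- by move=> x /K'K /sn /leq_trans; apply; rewrite ltnS.
Qed.

(** The functions are [outdist V_j], divided by their sum. The denominator is
    bounded below off [K] so that they are continuous on all of [X]. *)
Lemma small_partition_of_unity K n e (x0 : X) : compact K -> K x0 ->
  small_cover K n -> 0 < e ->
  exists m (phi : nat -> X -> R) (pt : nat -> X),
    [/\ (forall j, continuous (phi j)) /\ (forall j, K (pt j)),
        (forall x, K x -> \sum_(j < m) phi j x = 1),
        (forall j x, 0 <= phi j x),
        (forall j x, (j < m)%N -> K x -> phi j x != 0 -> mdist x (pt j) <= e) &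
        (forall x, K x -> (\sum_(j < m) (phi j x != 0%R) <= n.+1)%N)].
Proof.
move=> cK Kx0 /[apply] -[s [so sK sd sn]].
pose V j := nth set0 s j; pose m := size s.
have Vo j : open (V j).
  have [js|js] := ltnP j (size s); first by apply: so; exact: mem_nth.
  by rewrite /V nth_default//; exact: open0.
pose S x := \sum_(j < m) outdist (V j) x.
have cS : continuous S.
  by apply: continuous_sum => j; exact: outdist_continuous.
have Spos x : K x -> 0 < S x.
  move=> Kx; have /hasP[W /(nthP set0)[j js jW] /asboolP Wx] := sK x Kx.
  have Vjx : V j x by rewrite /V jW.
  rewrite /S (bigD1 (Ordinal js))//= ltr_wpDr ?sumr_ge0 ?outdist_gt0//.
  by move=> i _; exact: outdist_ge0.
have [eta eta0 etaP] := compact_pos_min cK cS Spos.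
pose phi j x := outdist (V j) x / Num.max (S x) eta.
pose pt j := if pselect (exists x, K x /\ V j x) is left H then projT1 (cid H)
  else x0.
have M0 x : 0 < Num.max (S x) eta by rewrite lt_max eta0 orbT.
have phi_neq0 j x : phi j x != 0 -> V j x.
  by move=> pn; apply: contrapT => nV; move: pn; rewrite /phi outdist_out// mul0r eqxx.
exists m, phi, pt; split=> //.
- split=> j.
    move=> x; apply: cvgM; first exact: outdist_continuous.
    apply: cvgV; first by rewrite gt_eqF.
    by apply: (continuous_max (cS x)); exact: cst_continuous.
  by rewrite /pt; case: pselect => // H; case: cid => ? [].
- move=> x Kx; rewrite -mulr_suml -/(S x) max_l ?etaP//.
  by rewrite divff// gt_eqF// Spos.
- by move=> j x; rewrite divr_ge0 ?outdist_ge0// ltW.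
- move=> j x jm Kx /phi_neq0 Vx; rewrite /pt.
  case: pselect => [H|[]]; last by exists x.
  by case: cid => /= y [Ky Vy]; apply: (sd (V j)) => //; exact: mem_nth.
- move=> x Kx; apply: leq_trans (sn x Kx); rewrite -sum1_count (big_nth set0).
  rewrite big_mkord [X in (_ <= X)%N]big_mkcond /=; apply: leq_sum => j _.
  by case: ifPn => [_|/asboolP nV]; [case: (_ != _)|case: eqP => // /eqP/phi_neq0].
Qed.

(** Tietze's theorem for the difference between the prescribed values and [f]. *)
Lemma extend_near (L : finType) (Z : L -> set X) (q : L -> X -> R) (f : X -> R)
    (e : R) : 0 < e -> (forall l, closed (Z l)) ->
  (forall l, continuous (q l)) -> continuous f ->
  (forall l z, Z l z -> `|q l z - f z| <= e) ->
  (forall l l' z, Z l z -> Z l' z -> q l z = q l' z) ->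
  exists f' : X -> R, [/\ continuous f', forall z, `|f' z - f z| <= e &
    forall l z, Z l z -> f' z = q l z].
Proof.
move=> e0 cZ cq cf qf qq.
pose F z := if [pick l | `[< Z l z >]] is Some l then q l z - f z else 0.
have FE l z : Z l z -> F z = q l z - f z.
  move=> Zlz; rewrite /F; case: pickP => [l' /asboolP Zl'|/(_ l)/asboolP//].
  by rewrite (qq l' l).
pose A (s : seq L) := \big[setU/set0]_(l <- s) Z l.
have clA s : closed (A s) by exact: closed_bigsetU.
have cF s : {within A s, continuous F}.
  elim: s => [|l s IH]; first by rewrite /A big_nil; exact: continuous_subspace0.
  rewrite /A big_cons; apply: withinU_continuous => //; first exact: clA.
  apply: (@subspace_eq_continuous _ (Z l) _ (fun z => q l z - f z) F).
    by move=> z /set_mem /FE.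
  apply: continuous_subspaceT => z; apply: cvgB; [exact: cq|exact: cf].
have AP s z : A s z -> exists l, Z l z.
  rewrite /A; elim: s => [|l s IH]; first by rewrite big_nil.
  by rewrite big_cons => -[Zl|/IH//]; exists l.
have AZ l z : Z l z -> A (enum L) z.
  have := mem_enum L l; rewrite /A; elim: (enum L) => [|l' s IH]; first by rewrite inE.
  rewrite inE big_cons => + Zl => /predU1P[<-|/IH]; by [left|right; auto].
have Fe z : A (enum L) z -> `|F z| <= e.
  by move=> /AP[l Zl]; rewrite (FE l)// qf.
have [g [Fg cg ge]] :=
  continuous_bounded_extension (@pseudometric_normal R X) (clA _) e0 (cF _) Fe.
exists (fun z => f z + g z); split.
- by move=> z; apply: cvgD; [exact: cf|exact: cg].
- by move=> z; rewrite addrC addKr.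
- move=> l z Zl; rewrite -Fg ?inE; last exact: AZ Zl.
  by rewrite (FE l)// addrC subrK.
Qed.

End SmallCovers.

(** * Perturbing a function along orbits *)

Section Perturbation.
Context {R : realType} {G : zmodType} {X : metricType R} (a : action G X).
Hypothesis cX : compact [set: X].

Lemma actK g : cancel (a g) (a (- g)).
Proof. by move=> x; rewrite -actD addNr act0. Qed.

Lemma actNK g : cancel (a (- g)) (a g).
Proof. by move=> x; rewrite -actD subrr act0. Qed.

Lemma act_inj g : injective (a g).
Proof. exact: can_inj (actK g). Qed.

(** The new values at the points [el l x], [x] in [K l], are averages of the
    numbers [u l j], which are close to the old values where they have weight. *)
Lemma interpolate (L : finType) (K : L -> set X) (el : L -> G) (m : L -> nat)
    (phi : L -> nat -> X -> R) (u : L -> nat -> R) (f : X -> R) (e : R) :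
  0 < e -> continuous f -> (forall l, closed (K l)) ->
  (forall l j, continuous (phi l j)) ->
  (forall l x, K l x -> \sum_(j < m l) phi l j x = 1) ->
  (forall l j x, 0 <= phi l j x) ->
  (forall l j x, (j < m l)%N -> K l x -> phi l j x != 0 ->
    `|u l j - f (a (el l) x)| <= e) ->
  (forall l l' x x', K l x -> K l' x' -> a (el l) x = a (el l') x' ->
    \sum_(j < m l) phi l j x * u l j = \sum_(j < m l') phi l' j x' * u l' j) ->
  exists f' : X -> R, [/\ continuous f', forall z, `|f' z - f z| <= e &
    forall l x, K l x -> f' (a (el l) x) = \sum_(j < m l) phi l j x * u l j].
Proof.
move=> e0 cf cK cphi phi1 phi0 close compat.
have [||||f' [cf' f'f f'E]] := @extend_near R X L (fun l => a (- el l) @^-1` K l)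
  (fun l z => \sum_(j < m l) phi l j (a (- el l) z) * u l j) f e e0 _ _ cf _ _.
- by move=> l; apply: closed_comp => // x _; exact: act_continuous.
- move=> l; apply: continuous_sum => j x.
  apply: cvgM; last exact: cvg_cst.
  by apply: (@continuous_comp _ _ _ (a (- el l)) (phi l j));
    [exact: act_continuous|exact: cphi].
- move=> l z Kz.
  apply: (@convex_close _ (m l) (fun j => phi l j (a (- el l) z)) (u l)).
  + exact: phi1.
  + by move=> j; exact: phi0.
  + by move=> j jm pj; rewrite -{1}(actNK (el l) z); exact: close pj.
- by move=> l l' z Kz Kz'; apply: compat => //; rewrite !actNK.
exists f'; split=> // l x Kx; rewrite (f'E l) /= ?actK//.
Qed.

Lemma unif_orbit (I : finType) (el : I -> G) D (f : 'I_D -> X -> R) e :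
  (forall c, continuous (f c)) -> 0 < e ->
  exists2 d, 0 < d & forall i c x y, mdist x y <= d ->
    `|f c (a (el i) x) - f c (a (el i) y)| <= e.
Proof.
move=> cf e0.
have [|[i c]|d d0 dP] := @uniform_pos R (I * 'I_D)%type (fun p d => forall x y,
    mdist x y <= d -> `|f p.2 (a (el p.1) x) - f p.2 (a (el p.1) y)| <= e).
- by move=> p d d' dP _ d'd x y /le_trans/(_ d'd); exact: dP.
- have [|d d0 dP] := @compact_unif_continuous R X (f c \o a (el i)) cX _ e e0.
    by move=> x; apply: continuous_comp; [exact: act_continuous|exact: cf].
  exists (d / 2) => [|x y xy]; first by rewrite divr_gt0.
  by apply/ltW/dP; apply: le_lt_trans xy _; rewrite ltr_pdivrMr// ltr_pMr// ltr1n.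
- by exists d => // i c; exact: (dP (i, c)).
Qed.

(** Only the vectors attached to the points [g i x], [x] in [K], are displaced. At
    the points [g i y] the new values are averages of old ones, so coincidences
    between these points are harmless as long as each of them holds either
    nowhere or everywhere on [K']. *)
Lemma perturb_pair D (f : 'I_D -> X -> R) e (K K' : set X) x0 y0 N (g : 'I_N -> G)
    n n' :
  (forall c, continuous (f c)) -> 0 < e ->
  closed K -> closed K' -> K x0 -> K' y0 ->
  (forall i l x x', K x -> K x' -> a (g i) x = a (g l) x' -> i = l) ->
  (forall i l x y, K x -> K' y -> a (g i) x <> a (g l) y) ->
  (forall i l y y' z, K' y -> K' y' -> K' z ->
    a (g i) y = a (g l) y' -> a (g i) z = a (g l) z) ->
  small_cover K n -> small_cover K' n' -> (n + n' < N * D)%N ->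
  exists f' : 'I_D -> X -> R, [/\ forall c, continuous (f' c),
    forall c x, `|f' c x - f c x| <= e &
    forall x y, K x -> K' y ->
      exists i c, f' c (a (g i) x) <> f' c (a (g i) y)].
Proof.
move=> cf e0 clK clK' Kx0 Ky0 sep cross coh Kn Kn' nND.
have e20 : 0 < e / 2 by rewrite divr_gt0.
have [d d0 dP] := unif_orbit g cf e20.
have cpt (A : set X) : closed A -> compact A by move=> ?; exact: subclosed_compact cX _.
have [m [phi [pt [[cphi Kpt] phi1 phi0 phid phin]]]] :=
  small_partition_of_unity (cpt _ clK) Kx0 Kn d0.
have [m' [psi [pt' [[cpsi Kpt'] psi1 psi0 psid psin]]]] :=
  small_partition_of_unity (cpt _ clK') Ky0 Kn' d0.
have [W [We WP]] := @general_position_mx R N D m' m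
  (fun j => \matrix_(i, c) f c (a (g i) (pt j)))
  (fun s => \matrix_(i, c) f c (a (g i) (pt' s))) _ e20.
have inter c : exists f' : X -> R, [/\ continuous f',
    forall z, `|f' z - f c z| <= e,
    forall i x, K x -> f' (a (g i) x) =
      \sum_(j < m) phi j x * (f c (a (g i) (pt j)) + W j i c) &
    forall i y, K' y -> f' (a (g i) y) =
      \sum_(s < m') psi s y * f c (a (g i) (pt' s))].
  pose el (l : 'I_N + 'I_N) := match l with inl i => g i | inr i => g i end.
  pose KK (l : 'I_N + 'I_N) := if l is inl _ then K else K'.
  pose mm (l : 'I_N + 'I_N) := if l is inl _ then m else m'.
  pose pp (l : 'I_N + 'I_N) := if l is inl _ then phi else psi.
  pose uu (l : 'I_N + 'I_N) j := match l with
    | inl i => f c (a (g i) (pt j)) + W j i c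
    | inr i => f c (a (g i) (pt' j)) end.
  have [||||||f' [cf' f'f f'E]] := @interpolate _ KK el mm pp uu (f c) e e0 (cf c).
  - by case.
  - by case.
  - by case.
  - by case.
  - case=> i j x jm Kx px /=.
    + rewrite addrAC (le_trans (ler_normD _ _))// [e]splitr lerD//.
      by apply: dP; rewrite metric_sym; exact: phid.
    + apply: (@le_trans _ _ (e / 2)); last by lra.
      by apply: dP; rewrite metric_sym; exact: psid.
  - case=> i; case=> l x x' /= Kx Kx' E.
    + by have il := sep i l x x' Kx Kx' E; move: E; rewrite il => /act_inj ->.
    + by case: (cross i l x x' Kx Kx' E).
    + by case: (cross l i x' x Kx' Kx (esym E)).
    + have gE z (K'z : K' z) := coh i l x x' z Kx Kx' K'z E.
      move: E; rewrite gE// => /act_inj ->.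
      by apply: eq_bigr => j _; rewrite gE.
  - exists f'; split=> // [i x Kx|i y Ky]; first exact: (f'E (inl i)).
    exact: (f'E (inr i)).
have [f' f'P] := choice inter.
exists f'; split=> [c|c z|x y Kx Ky]; [by case: (f'P c)|by case: (f'P c)|].
apply: contrapT => nex.
have := WP (phi ^~ x) (psi ^~ y) (phi1 x Kx) (psi1 y Ky).
case/(_ _)/negP.
  by apply: leq_trans (leq_add (phin x Kx) (psin y Ky)) _; lia.
apply/eqP/matrixP => i c; rewrite !summxE.
have [_ _ fx fy] := f'P c.
have E : f' c (a (g i) x) = f' c (a (g i) y).
  by apply: contrapT => E; apply: nex; exists i, c.
move: E; rewrite fx// fy// => E; under eq_bigr do rewrite !mxE.
by rewrite E; apply: eq_bigr => s _; rewrite !mxE.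
Qed.

(** The displacement [w j c] of the proof is a function of the orbit points of the centre
    [x0], zero except at the sources [g i x0], so that it is compatible with all
    coincidences. It changes the differences along the edges
    [(g i x0, (g i + h) x0)] by the matrix [1 - Q], where [Q] records which
    targets are sources; as [rho] decreases along edges, every change of the
    differences can be achieved. A coincidence means that a convex combination
    of the differences vanishes; hence the single vector [0] with weight [1] in
    [general_position_mx]. *)
Lemma perturb_translate D (f : 'I_D -> X -> R) e (K : set X) x0 N (g : 'I_N -> G)
    h n (rho : X -> nat) :
  (forall c, continuous (f c)) -> 0 < e -> closed K -> K x0 ->
  injective (fun i => a (g i) x0) ->
  (forall i, (rho (a (g i + h)%R x0) < rho (a (g i) x0))%N) ->
  let el (l : 'I_N + 'I_N) := match l with inl i => g i | inr i => g i + h end in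
  (forall l l' x x', K x -> K x' -> a (el l) x = a (el l') x' ->
    forall z, K z -> a (el l) z = a (el l') z) ->
  small_cover K n -> (n < N * D)%N ->
  exists f' : 'I_D -> X -> R, [/\ forall c, continuous (f' c),
    forall c x, `|f' c x - f c x| <= e &
    forall x, K x -> exists i c, f' c (a (g i) x) <> f' c (a (g i + h) x)].
Proof.
move=> cf e0 clK Kx0 ginj grho el coh Kn nND.
have e20 : 0 < e / 2 by rewrite divr_gt0.
have [d d0 dP] := unif_orbit el cf e20.
have cK : compact K by exact: subclosed_compact clK cX _.
have [m [phi [pt [[cphi Kpt] phi1 phi0 phid phin]]]] :=
  small_partition_of_unity cK Kx0 Kn d0.
pose Q : 'M[R]_N := \matrix_(i, l) (a (g i + h) x0 == a (g l) x0)%:R.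
have PU : 1%:M - Q \in unitmx.
  apply: (@unitmx_decreasing R N Q (fun i => rho (a (g i) x0))) => i l.
  rewrite mxE; have [<- _|_] := eqVneq (a (g i + h) x0) (a (g l) x0).
    exact: grho.
  by rewrite eqxx.
pose T := invmx (1%:M - Q).
pose C : R := \sum_l \sum_i `|T l i|.
have C0 : 0 <= C by rewrite sumr_ge0// => l _; rewrite sumr_ge0.
have C1 : 0 < C + 1 by lra.
have eC0 : 0 < e / 2 / (C + 1) by rewrite divr_gt0.
have [W [We WP]] := @general_position_mx R N D 1 m
  (fun j => \matrix_(i, c) (f c (a (g i) (pt j)) - f c (a (g i + h) (pt j))))
  (fun=> 0) _ eC0.
pose om j := T *m W j.
pose w j c z := \sum_l (z == a (g l) x0)%:R * om j l c.
have w_small j c z : `|w j c z| <= e / 2.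
  apply: (@le_trans _ _ (\sum_l \sum_i `|T l i| * (e / 2 / (C + 1)))).
    apply: (le_trans (ler_norm_sum _ _ _)); apply: ler_sum => l _.
    rewrite normrM (@le_trans _ _ `|om j l c|)//.
      by rewrite ler_piMl//; case: (_ == _); rewrite ?normr0 ?normr1 ?ler01.
    rewrite mxE; apply: (le_trans (ler_norm_sum _ _ _)); apply: ler_sum => i _.
    by rewrite normrM ler_wpM2l.
  under eq_bigr do rewrite -mulr_suml; rewrite -mulr_suml -/C.
  by rewrite mulrA ler_pdivrMr// mulrC ler_wpM2l ?ltW//; lra.
have w_vertex j c i : w j c (a (g i) x0) = om j i c.
  rewrite /w (bigD1 i)//= eqxx mul1r big1 ?addr0// => l li.
  by rewrite (inj_eq ginj) eq_sym (negPf li) mul0r.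
have w_target j c i : w j c (a (g i + h) x0) = (Q *m om j) i c.
  by rewrite mxE; apply: eq_bigr => l _; rewrite [Q i l]mxE.
have omE j : om j - Q *m om j = W j.
  by rewrite -[X in X - _]mul1mx -mulmxBl mulKVmx.
have inter c : exists f' : X -> R, [/\ continuous f',
    forall z, `|f' z - f c z| <= e &
    forall l x, K x -> f' (a (el l) x) =
      \sum_(j < m) phi j x * (f c (a (el l) (pt j)) + w j c (a (el l) x0))].
  apply: (@interpolate _ (fun=> K) el (fun=> m) (fun=> phi)
    (fun l j => f c (a (el l) (pt j)) + w j c (a (el l) x0))) => //.
  - move=> l j x jm Kx px; rewrite addrAC (le_trans (ler_normD _ _))//.
    rewrite [e]splitr lerD//.
    by apply: dP; rewrite metric_sym; exact: phid.
  - move=> l l' x x' Kx Kx' E; have gE := coh l l' x x' Kx Kx' E.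
    move: E; rewrite gE// => /act_inj ->.
    by apply: eq_bigr => j _; rewrite gE// gE.
have [f' f'P] := choice inter.
exists f'; split=> [c|c z|x Kx]; [by case: (f'P c)|by case: (f'P c)|].
apply: contrapT => nex.
have := WP (phi ^~ x) (fun=> 1) (phi1 x Kx) (big_ord1 _ _).
case/(_ _)/negP.
  rewrite big_ord1 oner_eq0 addn1 ltnS.
  exact: leq_trans (phin x Kx) _.
rewrite big_ord1 scaler0; apply/eqP/matrixP => i c; rewrite summxE [RHS]mxE.
have [_ _ fE] := f'P c.
have E : f' c (a (g i) x) = f' c (a (g i + h) x).
  by apply: contrapT => E; apply: nex; exists i, c.
move/eqP: E; rewrite (fE (inl i))// (fE (inr i))// -subr_eq0 -sumrB => /eqP E.
rewrite -[RHS]E; apply: eq_bigr => j _ /=.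
rewrite w_vertex w_target -mulrBr mxE -omE; congr (_ * _); rewrite !mxE.
by rewrite addrACA opprD.
Qed.

End Perturbation.

(** Points are ranked by their position in a list, or by the reverse of it: each
    edge descends for exactly one of the two rankings. *)
Lemma descending_half (T : eqType) N (p q : 'I_N -> T) :
  (forall i, p i != q i) ->
  exists N' (j : 'I_N' -> 'I_N) (rho : T -> nat),
    [/\ injective j, (N <= N'.*2)%N & forall i, (rho (q (j i)) < rho (p (j i)))%N].
Proof.
move=> pq; pose s := codom p ++ codom q; pose rho z := index z s.
have ps i : p i \in s by rewrite mem_cat codom_f.
have qs i : q i \in s by rewrite mem_cat codom_f orbT.
pose I1 : {set 'I_N} := finset (fun i => rho (q i) < rho (p i))%N.
have cover : (N <= #|I1| + #|~: I1|)%N by rewrite cardsC card_ord.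
have [le|lt] := leqP #|~: I1| #|I1|.
  exists #|I1|, enum_val, rho; split; [exact: enum_val_inj|lia|].
  by move=> i; have := enum_valP i; rewrite inE.
exists #|~: I1|, enum_val, (fun z => size s - rho z)%N.
split; [exact: enum_val_inj|lia|].
move=> i; have := enum_valP i; rewrite !inE -leqNgt leq_eqVlt => /orP[/eqP E|lti].
  by have := pq (enum_val i); rewrite -(nth_index (p (enum_val i)) (ps _))
    -/(rho _) E nth_index// eqxx.
have : (rho (q (enum_val i)) < size s)%N by rewrite index_mem.
lia.
Qed.

Section Pieces.
Context {R : realType} {G : zmodType} {X : metricType R} (a : action G X).
Hypothesis cX : compact [set: X].

(** The functions separating the pairs of [Om] contain a dense open set, for the
    uniform distance. *)
Definition generic_piece D (Om : X -> X -> Prop) : Prop :=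
  forall (f : 'I_D -> X -> R) e, (forall c, continuous (f c)) -> 0 < e ->
  exists (f' : 'I_D -> X -> R) d, [/\ forall c, continuous (f' c),
    forall c x, `|f' c x - f c x| <= e, 0 < d &
    forall f'' : 'I_D -> X -> R, (forall c x, `|f'' c x - f' c x| <= d) ->
      forall x y, Om x y -> exists g c, f'' c (a g x) <> f'' c (a g y)].

Lemma robust_separation D (T : topologicalType) (K : set T) (xi eta : T -> X)
    N (g : 'I_N -> G) (f : 'I_D -> X -> R) :
  compact K -> continuous xi -> continuous eta -> (forall c, continuous (f c)) ->
  (forall t, K t -> exists i c, f c (a (g i) (xi t)) <> f c (a (g i) (eta t))) ->
  exists2 d, 0 < d & forall f' : 'I_D -> X -> R,
    (forall c x, `|f' c x - f c x| <= d) ->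
    forall t, K t -> exists i c, f' c (a (g i) (xi t)) <> f' c (a (g i) (eta t)).
Proof.
move=> cK cxi ceta cf sep.
pose h t := \sum_i \sum_c `|f c (a (g i) (xi t)) - f c (a (g i) (eta t))|.
have ch : continuous h.
  apply: continuous_sum => i; apply: continuous_sum => c t.
  apply: cvg_norm; apply: cvgB.
    apply: (@continuous_comp _ _ _ xi (f c \o a (g i))); first exact: cxi.
    by apply: continuous_comp; [exact: act_continuous|exact: cf].
  apply: (@continuous_comp _ _ _ eta (f c \o a (g i))); first exact: ceta.
  by apply: continuous_comp; [exact: act_continuous|exact: cf].
have hpos t : K t -> 0 < h t.
  move=> /sep[i [c /eqP ne]]; rewrite /h (bigD1 i)//= (bigD1 c)//=.
  rewrite -addrA ltr_wpDr ?normr_gt0 ?subr_eq0// addr_ge0 ?sumr_ge0// => j _.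
  by rewrite sumr_ge0.
have [d d0 dP] := compact_pos_min cK ch hpos.
pose C : R := \sum_(i < N) \sum_(c < D) 2.
have C0 : 0 <= C by rewrite sumr_ge0// => i _; rewrite sumr_ge0.
exists (d / (C + 1)) => [|f' ff' t Kt]; first by rewrite divr_gt0//; lra.
apply: contrapT => nex; have := dP t Kt; rewrite leNgt => /negP; apply.
apply: (@le_lt_trans _ _ (C * (d / (C + 1)))); last first.
  by rewrite mulrA ltr_pdivrMr; [rewrite mulrC ltr_pM2l//; lra|lra].
rewrite /h /C mulr_suml; apply: ler_sum => i _.
rewrite mulr_suml; apply: ler_sum => c _.
have E : f' c (a (g i) (xi t)) = f' c (a (g i) (eta t)).
  by apply: contrapT => E; apply: nex; exists i, c.
have := ff' c (a (g i) (xi t)); have := ff' c (a (g i) (eta t)).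
by rewrite E !ler_norml => /andP[? ?] /andP[? ?]; apply/andP; split; lra.
Qed.

Definition fixed_by (S : seq G) : set X := [set x | forall s, s \in S -> a s x = x].

Lemma fixed_by_closed S : closed (fixed_by S).
Proof.
have -> : fixed_by S = \bigcap_(s in [set` S]) [set x | mdist (a s x) x = 0].
  apply/seteqP; split=> x /= xS s /xS /=; first by move=> ->; rewrite mdistxx.
  exact: mdist_positivity.
apply: closed_bigI => s _.
have -> : [set x | mdist (a s x) x = 0] =
  (fun x => mdist (a s x) x) @^-1` [set 0] by [].
apply: closed_comp; last exact: closed_eq.
move=> x _; apply: (@continuous_comp _ _ _ (fun x => (a s x, x))
  (fun p : X * X => mdist p.1 p.2)); last exact: mdist_continuous.
by apply: cvg_pair; [exact: act_continuous|exact: cvg_id].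
Qed.

Lemma local_separation g g' x y : a g x <> a g' y ->
  exists2 r, 0 < r & forall z z', mdist x z < r -> mdist y z' < r ->
    a g z <> a g' z'.
Proof.
move=> /eqP; rewrite -mdist_gt0; set d := mdist _ _ => d0.
have d20 : 0 < d / 2 by rewrite divr_gt0.
have /nbhs_ballP[r r0 rP] : \forall z \near x, ball (a g x) (d / 2) (a g z).
  exact: (@act_continuous _ _ a _ _ _ (nbhsx_ballx _ _ d20)).
have /nbhs_ballP[r' r'0 r'P] : \forall z \near y, ball (a g' y) (d / 2) (a g' z).
  exact: (@act_continuous _ _ a _ _ _ (nbhsx_ballx _ _ d20)).
exists (Num.min r r') => [|z z']; first by rewrite lt_min r0.
rewrite !lt_min => /andP[xz _] /andP[_ yz'] E.
have := rP z; have := r'P z'; rewrite !ballEmdist /= => /(_ yz') h' /(_ xz) h.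
have := metric_triangle (a g x) (a g z) (a g' y).
by rewrite E (metric_sym (a g' z')) -/d => ?; move: h' h; rewrite E; lra.
Qed.

(** What is used of a point [x]: generators [S] of its stabilizer, the dimension
    bound [n] for the points they fix, and [N] distinct points of its orbit. *)
Record orbit_type D (x : X) (S : seq G) (n N : nat) (g : 'I_N -> G) : Prop := OrbitType {
  ot_fixed : fixed_by S x;
  ot_stab : forall h, a h x = x -> forall z, fixed_by S z -> a h z = z;
  ot_cover : small_cover (fixed_by S) n;
  ot_inj : injective (fun i => a (g i) x);
  ot_dim : (n.*2 < N * D)%N }.

Lemma ot_coherent D x S n N (g : 'I_N -> G) : orbit_type D x S n g ->
  forall h h' z, fixed_by S z -> a h x = a h' x -> a h z = a h' z.
Proof.
move=> xT h h' z Sz E; apply: (act_inj (a := a) (g := - h')); rewrite actK -actD.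
by apply: (ot_stab xT) => //; rewrite actD E actK.
Qed.

(** As [N' <= N], the two dimension bounds give [n + n' < ND]. *)
Lemma different_orbits_generic D x y S n N (g : 'I_N -> G) S' n' N' (g' : 'I_N' -> G) :
  (forall h, a h x <> y) -> orbit_type D x S n g -> orbit_type D y S' n' g' ->
  (N' <= N)%N ->
  exists2 r, 0 < r & forall B B' : set X, closed B -> closed B' -> B x -> B' y ->
    (forall z, B z -> mdist x z < r) -> (forall z, B' z -> mdist y z < r) ->
    generic_piece D (fun z z' => (B `&` fixed_by S) z /\ (B' `&` fixed_by S') z').
Proof.
move=> xy xT yT N'N.
have cross i l : a (g i) x <> a (g l) y.
  by move=> E; apply: (xy (- g l + g i)); rewrite actD E actK.
have [|p|r r0 rP] := @uniform_pos R ('I_N * 'I_N)%type (fun p r =>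
    forall z z' w w', mdist x z < r -> mdist x z' < r -> mdist y w < r ->
      mdist y w' < r ->
      [/\ a (g p.1) z = a (g p.2) z' -> p.1 = p.2,
          a (g p.1) z <> a (g p.2) w &
          a (g p.1) w = a (g p.2) w' -> a (g p.1) y = a (g p.2) y]).
- move=> p d d' dP _ d'd z z' w w' xz xz' yw yw'.
  by apply: dP; [apply: lt_le_trans xz _|apply: lt_le_trans xz' _|
    apply: lt_le_trans yw _|apply: lt_le_trans yw' _].
- have [r2 r20 r2P] := local_separation (cross p.1 p.2).
  have [r1 r10 r1P] : exists2 r, 0 < r & forall z z', mdist x z < r ->
      mdist x z' < r -> a (g p.1) z = a (g p.2) z' -> p.1 = p.2.
    have [->|/eqP pp] := eqVneq p.1 p.2; first by exists 1.
    have [|r r0 rP] := @local_separation (g p.1) (g p.2) x x.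
      by move=> /(ot_inj xT).
    by exists r => // z z' xz xz' /(rP z z' xz xz').
  have [r3 r30 r3P] : exists2 r, 0 < r & forall w w', mdist y w < r ->
      mdist y w' < r -> a (g p.1) w = a (g p.2) w' -> a (g p.1) y = a (g p.2) y.
    have [E|] := pselect (a (g p.1) y = a (g p.2) y); first by exists 1.
    move=> /local_separation[r r0 rP].
    by exists r => // z z' xz xz' /(rP z z' xz xz').
  exists (Num.min r1 (Num.min r2 r3)) => [|z z' w w']; first by rewrite !lt_min r10 r20.
  rewrite !lt_min => /and3P[? ? ?] /and3P[? ? ?] /and3P[? ? ?] /and3P[? ? ?].
  by split; [exact: r1P|exact: r2P|exact: r3P].
exists r => // B B' clB clB' Bx B'y Br B'r f e cf e0.
have clK : closed (B `&` fixed_by S) by apply: closedI => //; exact: fixed_by_closed.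
have clK' : closed (B' `&` fixed_by S') by apply: closedI => //; exact: fixed_by_closed.
have xx : mdist x x < r by rewrite mdistxx.
have yy : mdist y y < r by rewrite mdistxx.
have [||||||||f' [cf' f'f f'sep]] := @perturb_pair R G X a cX D f e (B `&` fixed_by S)
    (B' `&` fixed_by S') x y N g n n' cf e0 clK clK'.
- by split=> //; exact: ot_fixed xT.
- by split=> //; exact: ot_fixed yT.
- move=> i l z z' [/Br xz _] [/Br xz' _].
  by have [] := rP (i, l) z z' y y xz xz' yy yy.
- move=> i l z w [/Br xz _] [/B'r yw _].
  by have [] := rP (i, l) z z w w xz xz yw yw.
- move=> i l w w' z [/B'r yw _] [/B'r yw' _] [_ Sz] E.
  have [_ _ /(_ E)] := rP (i, l) x x w w' xx xx yw yw'.
  exact: ot_coherent yT _ _ _ Sz.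
- by apply: small_cover_sub (ot_cover xT) => //; exact: subIsetr.
- by apply: small_cover_sub (ot_cover yT) => //; exact: subIsetr.
- have := ot_dim xT; have := ot_dim yT; have := leq_mul2r D N' N; lia.
have cK : compact ((B `&` fixed_by S) `*` (B' `&` fixed_by S')).
  by apply: compact_setX; [exact: subclosed_compact clK cX _|
    exact: subclosed_compact clK' cX _].
have [|||d d0 dP] := @robust_separation D _ _ fst snd N g f' cK _ _ cf'.
- by move=> p; exact: cvg_fst.
- by move=> p; exact: cvg_snd.
- by move=> [z w] [/= Kz Kw]; exact: f'sep.
exists f', d; split=> // f'' f''f' z w [Kz Kw].
have [i [c ic]] := dP f'' f''f' (z, w) (conj Kz Kw).
by exists (g i), c.
Qed.

(** At least half of the [N] edges [(g i x, (g i + h) x)] descend for a suitable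
    ranking, and half of [ND] exceeds [n]. *)
Lemma same_orbit_generic D x h S n N (g : 'I_N -> G) :
  a h x <> x -> orbit_type D x S n g ->
  exists2 r, 0 < r & forall B : set X, closed B -> B x ->
    (forall z, B z -> mdist x z < r) ->
    generic_piece D (fun z z' => (B `&` fixed_by S) z /\ z' = a h z).
Proof.
move=> hx xT.
have [|N' [j [rho [jinj NN' rhoP]]]] :=
    @descending_half X N (fun i => a (g i) x) (fun i => a (g i + h) x).
  by move=> i; rewrite actD; apply/eqP => /act_inj /esym.
pose el (l : 'I_N' + 'I_N') := match l with inl i => g (j i) | inr i => g (j i) + h end.
have [|p|r r0 rP] := @uniform_pos R (('I_N' + 'I_N') * ('I_N' + 'I_N'))%type
    (fun p r => forall z z', mdist x z < r -> mdist x z' < r ->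
      a (el p.1) z = a (el p.2) z' -> a (el p.1) x = a (el p.2) x).
- move=> p d d' dP _ d'd z z' xz xz'.
  by apply: dP; [apply: lt_le_trans xz _|apply: lt_le_trans xz' _].
- have [E|] := pselect (a (el p.1) x = a (el p.2) x); first by exists 1.
  move=> /local_separation[r r0 rP].
  by exists r => // z z' xz xz' /(rP z z' xz xz').
exists r => // B clB Bx Br f e cf e0.
have clK : closed (B `&` fixed_by S) by apply: closedI => //; exact: fixed_by_closed.
have [||||||f' [cf' f'f f'sep]] := @perturb_translate R G X a cX D f e
    (B `&` fixed_by S) x N' (g \o j) h n rho cf e0 clK.
- by split=> //; exact: ot_fixed xT.
- by move=> i i' /(ot_inj xT) /jinj.
- exact: rhoP.
- move=> l l' z z' [/Br xz _] [/Br xz' _] E w [_ Sw].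
  exact: ot_coherent xT _ _ _ Sw (rP (l, l') z z' xz xz' E).
- by apply: small_cover_sub (ot_cover xT) => //; exact: subIsetr.
- have := ot_dim xT; have : (N * D <= N'.*2 * D)%N by rewrite leq_mul2r NN' orbT.
  by rewrite -doubleMl; lia.
have cK : compact (B `&` fixed_by S) by exact: subclosed_compact clK cX _.
have [|||d d0 dP] := @robust_separation D _ _ idfun (a h) N' (g \o j) f' cK _ _ cf'.
- by move=> z; exact: cvg_id.
- exact: act_continuous.
- by move=> z Kz; have [i [c ic]] := f'sep z Kz; exists i, c; rewrite -actD.
exists f', d; split=> // f'' f''f' z _ [Kz ->].
have [i [c ic]] := dP f'' f''f' z Kz.
by exists (g (j i)), c.
Qed.

End Pieces.

(** * From mean dimension to covers of fixed point sets *)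

Section Stabilizer.
Context {G : zmodType} {X : topologicalType} (a : action G X) (x : X).

Definition stab : {pred G} := [pred g | `[< a g x = x >]].

Fact stab_zmod_closed : zmod_closed stab.
Proof.
split=> [|g h /asboolP gx /asboolP hx]; apply/asboolP; first exact: act0.
have hNx : a (- h) x = x by rewrite -{1}hx -actD addNr act0.
by rewrite actD hNx.
Qed.
HB.instance Definition _ := GRing.isZmodClosed.Build G stab stab_zmod_closed.

End Stabilizer.

Section FiniteGroups.
Context {R : realType} {G : zmodType} {X : metricType R} (a : action G X)
  (T : {fset G}) (T_full : forall g, g \in T).

Let card_T_gt0 : (0 < #|` T|)%N.
Proof. by rewrite cardfs_gt0; apply/fset0Pn; exists 0. Qed.

Lemma folner_full : folner R (fun=> T).
Proof.
split=> [_|g /=]; first by apply/fset0Pn; exists 0.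
have -> : [fset (g + h)%R | h in T]%fset = T.
  apply/fsetP => q; rewrite T_full; apply/imfsetP; exists (q - g) => //=.
  by rewrite addrC subrK.
by rewrite fsetDv fsetU0 cardfs0 mul0r; exact: cvg_cst.
Qed.

(** A ratio less than [1 / #|T|] forces the integer numerator to vanish, and a
    nonempty invariant set is everything. *)
Lemma folner_eventually_full (F : nat -> {fset G}) : folner R F ->
  \forall n \near \oo, F n = T.
Proof.
move=> [F0 FF].
have FT n : (#|` F n| <= #|` T|)%N by apply/fsubset_leq_card/fsubsetP => q _.
have Tinv0 : 0 < (#|` T|)%:R^-1 :> R by rewrite invr_gt0 ltr0n.
have inv g : \forall n \near \oo, forall h, h \in F n -> g + h \in F n.
  have /cvgrPdist_lt/(_ _ Tinv0) := FF g; apply: filterS => n /=.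
  rewrite sub0r normrN ger0_norm; last by rewrite divr_ge0.
  have Fn0 : 0 < (#|` F n|)%:R :> R by rewrite ltr0n cardfs_gt0.
  rewrite ltr_pdivrMr// => lt1.
  have : (#|` (F n `\` [fset (g + h)%R | h in F n]) `|`
      ([fset (g + h)%R | h in F n] `\` F n)|%fset)%:R < 1 :> R.
    apply: lt_le_trans lt1 _; rewrite mulrC ler_pdivrMr ?ltr0n// mul1r ler_nat.
    exact: FT.
  rewrite ltrn1 ltnS leqn0 cardfs_eq0 => /eqP E h hF.
  apply/negPn/negP => ghF; have : g + h \in (fset0 : {fset G}).
    rewrite -E in_fsetU !in_fsetD ghF /=.
    by apply/orP; right; apply/imfsetP; exists h.
  by rewrite in_fset0.
have invT : \forall n \near \oo, forall (i : 'I_(#|` T|)) h, h \in F n ->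
    nth 0 T i + h \in F n by apply: filter_forall => i; exact: inv.
apply: filterS invT => n invn; have /fset0Pn[h hF] := F0 n.
apply/fsetP => q; rewrite T_full -[q](subrK h).
have qT : (index (q - h)%R T < #|` T|)%N by rewrite index_mem T_full.
by have := invn (Ordinal qT) h hF; rewrite /= nth_index.
Qed.

Lemma widim_lt_mdim (r e : R) : (mdim a < r%:E)%E -> 0 < e ->
  (widim e (orbit_mdist a T) < (r * (#|` T|)%:R)%:E)%E.
Proof.
move=> mr e0; rewrite EFinM -lte_pdivrMr ?ltr0n//.
apply: le_lt_trans mr; rewrite /mdim.
set F := xget _ _; have FF : folner R F.
  by have := @xgetPex _ (fun=> fset0) [set F | folner R F]; apply; exists (fun=> T);
    exact: folner_full.
apply: ereal_sup_ubound; exists e => //.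
apply: lim_near_cst => //.
by have := folner_eventually_full FF; apply: filterS => n ->.
Qed.

End FiniteGroups.

Section CoverData.
Context {R : realType} {X : metricType R}.

Lemma small_cover_subspace (A : set X) n :
  (forall e, 0 < e -> exists U : set (set A), [/\ finite_open_cover U,
     (forall V, U V -> diam_le (fun x y : A => mdist (set_val x) (set_val y)) V e) &
     order_le U n]) ->
  small_cover A n.
Proof.
move=> H e e0; have [U [[finU oU covU] dU nU]] := H e e0.
have ext (V : set A) : exists O : set X, U V -> open O /\ V = set_val @^-1` O.
  have [/oU [O oO <-]|nV] := pselect (U V); first by exists O.
  by exists set0 => /nV.
have [E EP] := choice ext.
exists (map E (fset_set U)); split.
- by move=> _ /mapP[V VU ->]; have [] := EP V; rewrite in_fset_set// inE in VU.
- move=> x Ax; have [V UV Vx] := covU (exist _ x (mem_set Ax)).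
  apply/hasP; exists (E V).
    by apply/map_f; rewrite in_fset_set// inE.
  apply/asboolP; have [_] := EP V UV; move: Vx => /[swap] {1}->; exact.
- move=> _ x y /mapP[V VU ->] Ax + Ay; rewrite in_fset_set// inE in VU.
  have [_ VE] := EP V VU => Ex Ey.
  apply: (dU V VU (exist _ x (mem_set Ax)) (exist _ y (mem_set Ay))); by rewrite VE.
- move=> x Ax; pose x' : A := exist _ x (mem_set Ax).
  apply: leq_trans (geq_card_fset_set (nU x')).
  rewrite count_map -size_filter; apply: uniq_leq_size.
    by rewrite filter_uniq// fset_uniq.
  move=> V; rewrite mem_filter /= in_fset_set// => /andP[/asboolP Ex].
  rewrite inE => UV; rewrite in_fset_set; last exact: finite_setIl.
  by rewrite inE; split=> //=; have [_ ->] := EP V UV.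
Qed.

(** The compactness criterion is applied to the filter of all sets of finite sets
    that contain every sufficiently large finite set. *)
Lemma compact_net e : compact [set: X] -> 0 < e ->
  exists D : {fset X}, forall x, exists2 y, y \in D & mdist y x < e.
Proof.
move=> /compact_near_coveringP cov e0.
pose F : set_system {fset X} :=
  filter_from setT (fun D => [set D' : {fset X} | (D `<=` D')%fset]).
have FF : Filter F.
  apply: filter_from_filter => [|D D' _ _]; first by exists fset0.
  by exists (D `|` D')%fset => // E; rewrite /= fsubUset => /andP.
have [x _|D _ DP] :=
    cov _ F (fun (D : {fset X}) x => exists2 y, y \in D & mdist y x < e) FF.
  exists (ball x e, [set D : {fset X} | ([fset x] `<=` D)%fset]).
    by split; [exact: nbhsx_ballx|exists [fset x]%fset].
  move=> [z D] [/=]; rewrite ballEmdist fsub1set => xz xD.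
  by exists x.
by exists D => x; apply: (DP D) => //; exact: fsubset_refl.
Qed.

Lemma small_cover_covering_dim n : compact [set: X] -> covering_dim_le X n ->
  small_cover [set: X] n.
Proof.
move=> cX Xn e e0; have e20 : 0 < e / 2 by rewrite divr_gt0.
have [D DX] := compact_net cX e20.
pose U := [set [set z | mdist x z < e / 2] | x in [set` D]].
have [|V [[finV oV covV] VU Vn]] := Xn U.
  split.
  - by apply: finite_image; exact: finite_fset.
  - by move=> _ [x _ <-]; exact: open_mdist_lt.
  - move=> x; have [y yD xy] := DX x.
    by exists [set z | mdist y z < e / 2] => //; exists y.
exists (fset_set V); split.
- by move=> W; rewrite in_fset_set// inE; exact: oV.
- move=> x _; have [W VW Wx] := covV x; apply/hasP; exists W; last exact/asboolP.
  by rewrite in_fset_set// inE.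
- move=> W x y; rewrite in_fset_set// inE => /VU[_ [z _ <-] Wz] _ Wx _ Wy.
  have /= zx := Wz x Wx; have /= zy := Wz y Wy; have := metric_triangle x z y.
  by rewrite (metric_sym x z); lra.
- move=> x _; apply: leq_trans (geq_card_fset_set (Vn x)).
  rewrite -size_filter; apply: uniq_leq_size; first by rewrite filter_uniq// fset_uniq.
  move=> W; rewrite mem_filter /= in_fset_set// => /andP[/asboolP Wx].
  rewrite inE => VW; rewrite in_fset_set; last exact: finite_setIl.
  by rewrite inE; split.
Qed.

End CoverData.

Section OrbitTypes.
Context {R : realType} {k D : nat} {X : metricType R} (a : action 'rV[int]_k X).
Hypotheses (D_gt0 : (0 < D)%N) (cX : compact [set: X])
  (X_dim : finite_dimensional X)
  (X_mdim : forall A : zmodClosed 'rV[int]_k, fixed_set a A !=set0 ->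
      (mdim (induced_action a A) < (D%:R / 2)%:E)%E).

Lemma orbit_type_exists x : exists S n N (g : 'I_N -> 'rV[int]_k),
  orbit_type a D x S n g.
Proof.
pose A : zmodClosed 'rV[int]_k := stab a x.
have Ax : fixed_set a A x by move=> n /asboolP.
have [S [SA SP]] := subgroup_fg A.
have AS : fixed_set a A = fixed_by a S.
  apply/seteqP; split=> z zP; first by move=> s /SA; exact: zP.
  move=> n nA; have /asboolP// : n \in stab a z.
  by apply: (SP (stab a z)) nA => s sS; apply/asboolP; exact: zP.
have Sx : fixed_by a S x by rewrite -AS.
have Sstab h : a h x = x -> forall z, fixed_by a S z -> a h z = z.
  by move=> hx z; rewrite -AS; apply; apply/asboolP.
have rep_inj (T : {fset {ideal_quot A}}) :
    injective (fun i : 'I_(#|` T|) => a (repr (nth 0 T i)) x).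
  move=> i j E; apply/val_inj/eqP; rewrite -(nth_uniq 0 (ltn_ord i) (ltn_ord j) (fset_uniq T)).
  rewrite -[nth _ _ i]reprK -[nth _ _ j]reprK -Quotient.idealrBE.
  by apply/asboolP; rewrite addrC actD E -actD addNr act0.
have [finQ|infQ] := pselect (finite_set [set: {ideal_quot A}]); last first.
  have [d Xd] := X_dim; have [F _ dF] := infinite_set_fset d.*2.+1 infQ.
  exists S, d, #|` F|, (fun i => repr (nth 0 F i)); split=> //.
    exact: small_cover_sub (small_cover_covering_dim cX Xd).
  by rewrite (leq_trans dF)// leq_pmulr.
pose T := fset_set [set: {ideal_quot A}].
have T_full q : q \in T by rewrite in_fset_set// inE.
pose p := #|` T|.
have small e : 0 < e -> exists n (U : set (set (fixed_set a A))),
    [/\ (n.*2 < p * D)%N, finite_open_cover U,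
     (forall V, U V -> diam_le (fun x y : fixed_set a A =>
        mdist (set_val x) (set_val y)) V e) & order_le U n].
  move=> e0; have Ane : fixed_set a A !=set0 by exists x.
  have := widim_lt_mdim T_full (X_mdim Ane) e0.
  move=> /ereal_inf_lt[_ [n [U [Ucov Ud Un]] <-]]; rewrite lte_fin => nlt.
  exists n, U; split=> //.
    rewrite -(ltr_nat R) -muln2 !natrM -ltr_pdivlMr//.
    by move: nlt; rewrite mulrAC [D%:R * _]mulrC.
  move=> V UV y z Vy Vz; apply: le_trans (Ud V UV y z Vy Vz).
  rewrite /orbit_mdist.
  have -> : mdist (set_val y) (set_val z) =
     mdist (induced_action a A 0 y) (induced_action a A 0 z) by rewrite !act0.
  exact: (@le_bigmax_seq _ _ _ (enum_fset T) 0 0 xpredT (fun g =>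
    mdist (induced_action a A g y) (induced_action a A g z)) (T_full 0)).
have [n0 [_ [n0p _ _ _]]] := small 1 ltr01.
(* the largest [n] such that [2n < pD], whatever the scale [e] *)
exists S, (p * D).-1./2, p, (fun i => repr (nth 0 T i)); split=> //.
- rewrite -AS; apply: small_cover_subspace => e /small[n [U [np Uc Ud Un]]].
  exists U; split=> // y; apply: card_le_trans (Un y) _; rewrite card_le_II ltnS.
  by have := odd_double_half (p * D).-1; lia.
- exact: rep_inj.
- by have := odd_double_half (p * D).-1; lia.
Qed.

End OrbitTypes.

(** * Genericity and the embedding *)

Section Baire.
Context {R : realType} {G : zmodType} {X : metricType R} (a : action G X).

(** Closed balls around the points of finite nets of mesh [1 / n.+1]. *)
Lemma closed_base : compact [set: X] ->
  exists B : nat * nat -> set X, (forall i, closed (B i)) /\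
    forall x e, 0 < e -> exists i, B i x /\ forall z, B i z -> mdist x z < e.
Proof.
move=> cX; have net n : exists D : {fset X}, forall x,
    exists2 y, y \in D & mdist y x < n.+1%:R^-1.
  by apply: compact_net => //; rewrite invr_gt0.
have [D DP] := choice net.
exists (fun i => if onth (D i.1) i.2 is Some c
  then [set z | mdist c z <= i.1.+1%:R^-1] else set0); split=> [i|x e e0].
  by case: onth => [c|]; [exact: closed_mdist_le|exact: closed0].
have e20 : 0 < e / 2 by rewrite divr_gt0.
have [n] := ltr_add_invr e20; rewrite add0r => ne.
have [y /onthP[j jy] yx] := DP n x.
exists (n, j); rewrite /= jy /=; split=> [|z /= yz]; first exact: ltW.
have := metric_triangle x y z; rewrite (metric_sym x y).
by move: (n.+1%:R^-1) ne yx yz => r *; lra.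
Qed.

(** A sequence [f n] with tolerances [e n] is built so that every function within
    [e n.+1] of [f n.+1] separates the [n]th piece, if that piece is generic, and
    so that the intervals from [f n - e n] to [f n + e n] have a common point
    [F], the supremum of their left ends. The start [f 0 = 0], [e 0 = 1] bounds [F] by [1]. *)
Lemma generic_separation D (I : countType) (Om : I -> X -> X -> Prop) :
  exists F : 'I_D -> X -> R, [/\ forall c, continuous (F c),
    forall c x, `|F c x| <= 1 &
    forall i, generic_piece a D (Om i) -> forall x y, Om i x y ->
      exists g c, F c (a g x) <> F c (a g y)].
Proof.
pose good (s : ('I_D -> X -> R) * R) := (forall c, continuous (s.1 c)) /\ 0 < s.2.
pose next (n : nat) (s s' : ('I_D -> X -> R) * R) :=
  [/\ forall c x, `|s'.1 c x - s.1 c x| <= s.2 / 2, s'.2 <= s.2 / 2 &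
    forall i : I, @choice.unpickle I n = Some i -> generic_piece a D (Om i) ->
      forall f, (forall c x, `|f c x - s'.1 c x| <= s'.2) ->
      forall x y, Om i x y -> exists g c, f c (a g x) <> f c (a g y)].
have step (p : nat * (('I_D -> X -> R) * R)) :
    exists s', good p.2 -> good s' /\ next p.1 p.2 s'.
  case: p => n [f e] /=.
  have [[/= cf e0]|ng] := pselect (good (f, e)); last by exists (f, e).
  have e20 : 0 < e / 2 by rewrite divr_gt0.
  have [[i ni gi]|ngen] :=
      pselect (exists2 i : I, @choice.unpickle I n = Some i & generic_piece a D (Om i)).
    have [f' [d [cf' f'f d0 dP]]] := gi f (e / 2) cf e20.
    exists (f', Num.min d (e / 2)) => _; split; first by split=> //=; rewrite lt_min d0.
    split=> //=; first by rewrite ge_min lexx orbT.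
    move=> j; rewrite ni => -[<-] _ f'' f''f' x y; apply: dP => c z.
    by apply: le_trans (f''f' c z) _; rewrite ge_min lexx.
  exists (f, e / 2) => _; split=> //; split=> //= [c x|i ni gi].
    by rewrite subrr normr0 ltW.
  by case: ngen; exists i.
have [nxt nxtP] := choice step.
pose s := fix s n := if n is m.+1 then nxt (m, s m)
  else ((fun _ _ => 0) : 'I_D -> X -> R, 1 : R).
have sgood n : good (s n).
  elim: n => [|n IH]; last by have [] := nxtP (n, s n) IH.
  by split=> /= [c|//]; exact: cst_continuous.
have snext n : next n (s n) (s n.+1) by have [] := nxtP (n, s n) (sgood n).
pose f n := (s n).1; pose e n := (s n).2.
have e_gt0 n : 0 < e n by have [] := sgood n.
have eS n : e n.+1 <= e n / 2 by have [] := snext n.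
have e_le n : e n <= n.+1%:R^-1.
  elim: n => [|n IH]; first by rewrite /e /= invr1.
  apply: le_trans (eS n) _; apply: le_trans (ler_wpM2r _ IH) _ => //.
  by rewrite -invfM lef_pV2 ?posrE// -natrM ler_nat; lia.
have f_tele n m c x : `|f (n + m)%N c x - f n c x| <= e n - e (n + m)%N.
  elim: m => [|m IH]; first by rewrite addn0 !subrr normr0.
  rewrite addnS; have [fS _ _] := snext (n + m)%N; have := fS c x.
  have := eS (n + m)%N; rewrite -/(f _) -/(f _) -/(e _) => eSn fSn.
  rewrite -[f _.+1 c x](subrK (f (n + m)%N c x)) -addrA.
  by apply: (le_trans (ler_normD _ _)); lra.
have f_close n m c x : `|f n c x - f m c x| <= e n + e m.
  have [nm|/ltnW mn] := leqP n m.
    rewrite distrC -(subnKC nm); have := f_tele n (m - n)%N c x.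
    by have := e_gt0 (n + (m - n))%N; lra.
  rewrite -(subnKC mn); have := f_tele m (n - m)%N c x.
  by have := e_gt0 (m + (n - m))%N; lra.
pose A c x := [set f n c x - e n | n in [set: nat]].
have Aub c x m : ubound (A c x) (f m c x + e m).
  move=> _ [n _ <-]; have := f_close n m c x; rewrite ler_norml => /andP[_].
  lra.
pose F c x := sup (A c x).
have F_close n c x : `|F c x - f n c x| <= e n.
  have A0 : A c x !=set0 by exists (f n c x - e n), n.
  have : F c x <= f n c x + e n by apply: ge_sup => //; exact: Aub.
  have : f n c x - e n <= F c x.
    by apply: ub_le_sup; [exists (f n c x + e n); exact: Aub|exists n].
  by move=> *; rewrite ler_norml; apply/andP; split; lra.
exists F; split=> [c|c x|i gi x y].
- apply/continuous_mdistP => x r r0.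
  have r30 : 0 < r / 3 by rewrite divr_gt0.
  have [n] := ltr_add_invr r30; rewrite add0r => nr.
  have en : e n < r / 3 by exact: le_lt_trans (e_le n) nr.
  have [cfn _] := sgood n.
  have /continuous_mdistP/(_ x _ r30)[d d0 dP] := cfn c.
  exists d => // y /dP; rewrite -/(f n).
  have := F_close n c x; have := F_close n c y.
  rewrite !ler_norml !ltr_norml => /andP[? ?] /andP[? ?] /andP[? ?].
  by apply/andP; split; lra.
- by have := F_close 0%N c x; rewrite subr0.
- have [_ _ sepn] := snext (choice.pickle i); apply: (sepn i (choice.pickleK i) gi F) => c z.
  exact: (F_close (choice.pickle i).+1).
Qed.

End Baire.

(** The two families of pieces are indexed by countable types, since their data
    are finite lists in [Z^k], an element of [Z^k] and members of a countable
    family of closed sets. *)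
Lemma separating_observable (R : realType) (k D : nat) (X : metricType R)
    (a : action 'rV[int]_k X) :
  (0 < D)%N -> compact [set: X] -> finite_dimensional X ->
  (forall A : zmodClosed 'rV[int]_k, fixed_set a A !=set0 ->
    (mdim (induced_action a A) < (D%:R / 2)%:E)%E) ->
  exists F : 'I_D -> X -> R, [/\ forall c, continuous (F c),
    forall c x, `|F c x| <= 1 &
    forall x y, x <> y -> exists g c, F c (a g x) <> F c (a g y)].
Proof.
move=> D0 cX X_dim X_mdim; have [B [clB Bbase]] := closed_base cX.
have ot := orbit_type_exists D0 cX X_dim X_mdim.
pose G : countType := 'rV[int]_k; pose J : countType := (nat * nat)%type.
pose I : countType := ((seq G * J * (seq G * J)) + (seq G * J * G))%type.
pose Om (i : I) (z z' : X) : Prop := match i with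
  | inl (s, j, (s', j')) => (B j `&` fixed_by a s) z /\ (B j' `&` fixed_by a s') z'
  | inr (s, j, h) => (B j `&` fixed_by a s) z /\ z' = a h z end.
have [F [cF F1 Fsep]] := generic_separation a D Om.
exists F; split=> // x y xy.
have [S [n [N [g xT]]]] := ot x; have [S' [n' [N' [g' yT]]]] := ot y.
have [[h hxy]|nh] := pselect (exists h, a h x = y).
  have hx : a h x <> x by rewrite hxy => /esym.
  have [r r0 rP] := same_orbit_generic cX hx xT.
  have [j [Bx Br]] := Bbase x r r0.
  apply: (Fsep (inr (S, j, h)) (rP _ (clB j) Bx Br)).
  by split=> //; split=> //; exact: ot_fixed xT.
have hxy h : a h x <> y by move=> E; apply: nh; exists h.
have hyx h : a h y <> x by move=> E; apply: (hxy (- h)); rewrite -E actK.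
have [le|/ltnW le] := leqP N' N.
  have [r r0 rP] := different_orbits_generic cX hxy xT yT le.
  have [j [Bx Br]] := Bbase x r r0; have [j' [By Br']] := Bbase y r r0.
  apply: (Fsep (inl (S, j, (S', j'))) (rP _ _ (clB j) (clB j') Bx By Br Br')).
  by split; split=> //; [exact: ot_fixed xT|exact: ot_fixed yT].
have [r r0 rP] := different_orbits_generic cX hyx yT xT le.
have [j [Bx Br]] := Bbase x r r0; have [j' [By Br']] := Bbase y r r0.
have [|q [c qc]] := Fsep (inl (S', j', (S, j))) (rP _ _ (clB j') (clB j) By Bx Br' Br) y x.
  by split; split=> //; [exact: ot_fixed yT|exact: ot_fixed xT].
by exists q, c => /esym.
Qed.

Theorem mainTheorem5 (R : realType) (k D : nat) (X : metricType R)
    (a : action 'rV[int]_k X)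
    (k_ge1 : (1 <= k)%N) (D_ge1 : (1 <= D)%N)
    (X_compact : compact [set: X]) (X_dim : finite_dimensional X)
    (X_mdim : forall A : zmodClosed 'rV[int]_k, fixed_set a A !=set0 ->
      (mdim (induced_action a A) < (D%:R / 2)%:E)%E) :
  embeds a (cubical_shift R D k).
Proof.
have [F [cF F1 Fsep]] : exists F : 'I_D -> X -> R, [/\ forall c, continuous (F c),
    forall c x, `|F c x| <= 1 &
    forall x y, x <> y -> exists g c, F c (a g x) <> F c (a g y)].
  exact: separating_observable.
have Fitv c x : [set` `[0, 1]] ((1 + F c x) / 2).
  rewrite /= in_itv /=; have := F1 c x; rewrite ler_norml => /andP[? ?].
  by apply/andP; split; lra.
pose phi (x : X) : cube_seq R D k :=
  fun n c => exist _ ((1 + F c (a n x)) / 2) (mem_set (Fitv c (a n x))).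
exists phi; split.
- move=> x; apply/cvg_sup => n.
  apply: (@continuous_comp_initial _ X (cube R D) (fun f => f n)) => {}x.
  apply/cvg_sup => c.
  apply: (@continuous_comp_initial (cube R D) X (set_type (@unit_interval R))
    (fun f => f c) (fun x => phi x n)) => {}x.
  apply: continuous_comp_initial => {}x.
  apply: cvgM; last exact: cvg_cst.
  apply: cvgD; first exact: cvg_cst.
  by apply: continuous_comp; [exact: act_continuous|exact: cF].
- move=> x y xy; apply: contrapT => /Fsep[g [c]]; apply.
  have /(congr1 (fun f : cube_seq R D k => set_val (f g c))) := xy.
  by move=> /= /mulIf-/(_ _)/addrI; apply; rewrite invr_eq0 pnatr_eq0.
- move=> g x; apply/funext => n; apply/funext => c; apply: val_inj => /=.
  by rewrite actD.
Qed.
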